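(* Let $\alpha>0$, $\beta>1$ with $\gamma:=\alpha+\beta>2$, and let $f,g^1,g^2:D\to\mathbb{R}$ be continuous with $[\delta f]_\alpha+[\delta g^1\cup\delta g^2]_\beta<\infty$. Then the $2$-germ $f\cup\delta(g^1\,\mathsf{d}g^2)$ is $\gamma$-sewable and, writing $f\,\mathsf{d}(g^1\,\mathsf{d}g^2):=\operatorname{sew}(f\cup\delta(g^1\,\mathsf{d}g^2))$, one has $$[f\cup\delta(g^1\,\mathsf{d}g^2)-f\,\mathsf{d}(g^1\,\mathsf{d}g^2)]_\gamma\le c\,[\delta f]_\alpha\,[\delta g^1\cup\delta g^2]_\beta,$$ where $c=c(\alpha,\beta)$ is a constant depending only on $\alpha$ and $\beta$.
   Context: Let $D\subseteq\mathbb{R}^d$ be a set. A $k$-simplex in $D$ is a tuple $S=[p_0p_1\ldots p_k]\in D^{k+1}$ with $\operatorname{conv}(S)\subseteq D$; $\operatorname{Simp}^k(D)$ is the set of $k$-simplices. A $k$-germ in $D$ is a function $\omega:\operatorname{Simp}^k(D)\to\mathbb{R}$, written $\omega_S=\langle S,\omega\rangle$ and extended linearly to chains (finite real linear combinations of simplices); $0$-germs are functions on $D$. The boundary is $\partial[p_0\ldots p_k]=\sum_{i=0}^k(-1)^i[p_0\ldots\hat p_i\ldots p_k]$, and $\langle S,\delta\omega\rangle:=\langle\partial S,\omega\rangle$; in particular $(\delta f)_{pq}=f_q-f_p$. The cup product of a $k$-germ $\omega$ and an $h$-germ $\tilde\omega$ is $(\omega\cup\tilde\omega)_{p_0\ldots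 p_{k+h}}=\omega_{p_0\ldots p_k}\tilde\omega_{p_k\ldots p_{k+h}}$. For a simplex $S$, $\operatorname{diam}(S)$ is the maximal distance between its vertices. For a germ $\omega$, $[\omega]_\gamma\in[0,\infty]$ is the infimum of constants $c\ge0$ with $|\omega_S|\le c\operatorname{diam}(S)^\gamma$ for all simplices $S$ (of the relevant dimension) in $D$. For $k\in\{1,2\}$, a $k$-germ $\omega$ is nonatomic if $\omega_S=0$ whenever $\operatorname{vol}_k(S)=0$ (i.e. the vertices of $S$ lie in an affine subspace of dimension $<k$); it is closed on $k$-planes if $\langle T,\delta\omega\rangle=0$ for every $T\in\operatorname{Simp}^{k+1}(D)$ whose vertices lie in an affine $k$-plane; it is regular if it is both. For $\gamma>k$, a $k$-germ $\omega$ is $\gamma$-sewable if there exists a (necessarily unique) regular $k$-germ $\operatorname{sew}\omega$ with $[\omega-\operatorname{sew}\omega]_\gamma<\infty$. If $\beta>1$ and $[\delta g^1\cup\delta g^2]_\beta<\infty$ with $g^1,g^2$ continuous, the $1$-germ $g^1\cup\delta g^2$ is $\beta$-sewable, and $g^1\,\mathsf{d}g^2:=\operatorname{sew}(g^1\cup\delta g^2)$ (Young integral). *)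

(* Defs.v *)
From mathcomp Require Import all_boot all_order all_algebra.
From mathcomp Require Import all_classical all_reals all_analysis.
Import Order.TTheory GRing.Theory Num.Theory.
Import numFieldNormedType.Exports.

Set Implicit Arguments.
Unset Strict Implicit.
Unset Printing Implicit Defensive.

Local Open Scope classical_set_scope.
Local Open Scope ring_scope.

(* The library norm on ['rV[R]_d] is the sup norm. Distances here are
   Euclidean: the constant in the estimate must not depend on [d]. *)
Definition edist (R : realType) (d : nat) (p q : 'rV[R]_d) : R :=
  Num.sqrt (\sum_(j < d) (p 0 j - q 0 j) ^+ 2).

Definition conv_hull (R : realType) (d k : nat) (p : 'I_k.+1 -> 'rV[R]_d) :
    set 'rV[R]_d :=
  [set x | exists t : 'I_k.+1 -> R,
     [/\ forall i, 0 <= t i, \sum_i t i = 1 & x = \sum_i t i *: p i]].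

Record simplex (R : realType) (d : nat) (D : set 'rV[R]_d) (k : nat) := Simplex {
  vertex :> 'I_k.+1 -> 'rV[R]_d;
  simplex_conv : conv_hull vertex `<=` D }.

Lemma conv_hull_reindex (R : realType) (d k m : nat)
    (p : 'I_k.+1 -> 'rV[R]_d) (h : 'I_m.+1 -> 'I_k.+1) :
  conv_hull (p \o h) `<=` conv_hull p.
Proof.
move=> x [t [t0 t1 ->]].
exists (fun i => \sum_(j | h j == i) t j); split.
- by move=> i; apply: sumr_ge0.
- by rewrite -t1 [RHS](partition_big h xpredT).
- rewrite [LHS](partition_big h xpredT) //=; apply: eq_bigr => i _.
  by rewrite scaler_suml; apply: eq_bigr => j /eqP ->.
Qed.

Definition reindex_simplex (R : realType) (d : nat) (D : set 'rV[R]_d)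
    (k m : nat) (h : 'I_m.+1 -> 'I_k.+1) (S : simplex D k) : simplex D m :=
  Simplex (subset_trans (@conv_hull_reindex R d k m S h) (@simplex_conv _ _ _ _ S)).

Definition germ (R : realType) (d : nat) (D : set 'rV[R]_d) (k : nat) :=
  simplex D k -> R.

(* Only the values of [f] on [D] matter. *)
Definition germ0 (R : realType) (d : nat) (D : set 'rV[R]_d)
    (f : 'rV[R]_d -> R) : germ D 0 :=
  fun S => f (S ord0).
Arguments germ0 {R d} D f.

Definition delta (R : realType) (d : nat) (D : set 'rV[R]_d) (k : nat)
    (w : germ D k) : germ D k.+1 :=
  fun S => \sum_(i < k.+2) (-1) ^+ i * w (reindex_simplex (lift i) S).

(* All the [inord]s below are in range: [i <= k + h] and [k + i <= k + h]. *)
Definition cup (R : realType) (d : nat) (D : set 'rV[R]_d) (k h : nat)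
    (w : germ D k) (w' : germ D h) : germ D (k + h) :=
  fun S => w (reindex_simplex (fun i : 'I_k.+1 => inord i) S) *
           w' (reindex_simplex (fun i : 'I_h.+1 => inord (k + i)) S).

Definition diam (R : realType) (d : nat) (D : set 'rV[R]_d) (k : nat)
    (S : simplex D k) : R :=
  \big[Num.max/0]_(i < k.+1) \big[Num.max/0]_(j < k.+1) edist (S i) (S j).

(* [w]_g, with value +oo when no constant is admissible. *)
Definition germ_norm (R : realType) (d : nat) (D : set 'rV[R]_d) (k : nat)
    (g : R) (w : germ D k) : \bar R :=
  ereal_inf [set c%:E | c in
    [set c : R | 0 <= c /\ forall S : simplex D k, `|w S| <= c * diam S `^ g]].

Definition in_affine (R : realType) (d m n : nat)
    (p : 'I_n -> 'rV[R]_d) : Prop :=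
  exists (q : 'rV[R]_d) (V : {vspace 'rV[R]_d}),
    \dim V = m /\ forall i, p i - q \in V.

Definition nonatomic (R : realType) (d : nat) (D : set 'rV[R]_d) (k : nat)
    (w : germ D k) : Prop :=
  forall S : simplex D k,
    (exists2 m : nat, (m < k)%N & in_affine m S) -> w S = 0.

Definition closed_on_planes (R : realType) (d : nat) (D : set 'rV[R]_d)
    (k : nat) (w : germ D k) : Prop :=
  forall T : simplex D k.+1, in_affine k T -> delta w T = 0.

Definition regular (R : realType) (d : nat) (D : set 'rV[R]_d) (k : nat)
    (w : germ D k) : Prop :=
  nonatomic w /\ closed_on_planes w.

Definition is_sew (R : realType) (d : nat) (D : set 'rV[R]_d) (k : nat)
    (g : R) (w e : germ D k) : Prop :=
  regular e /\ (germ_norm g (w \- e)%R < +oo)%E.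

Definition sewable (R : realType) (d : nat) (D : set 'rV[R]_d) (k : nat)
    (g : R) (w : germ D k) : Prop :=
  exists e : germ D k, is_sew g w e.

(* For [k < g] a sewing is unique if it exists, so this choice is then
   canonical; the default value 0 is only taken on non-sewable germs. *)
Definition sew (R : realType) (d : nat) (D : set 'rV[R]_d) (k : nat)
    (g : R) (w : germ D k) : germ D k :=
  xget (fun=> 0) [set e : germ D k | is_sew g w e].

(* The Young integral g1 dg2. *)
Definition young (R : realType) (d : nat) (D : set 'rV[R]_d) (b : R)
    (g1 g2 : 'rV[R]_d -> R) : germ D 1 :=
  sew b (cup (germ0 D g1) (delta (germ0 D g2)) : germ D 1).
Arguments young {R d} D b g1 g2.

(* Main.v *)
From Pilot Require Import Defs.
From mathcomp Require Import all_boot all_order all_algebra.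
From mathcomp Require Import all_classical all_reals all_analysis.
From mathcomp Require Import ring lra.
Import Order.TTheory GRing.Theory Num.Theory.
Import numFieldNormedType.Exports.

Set Implicit Arguments.
Unset Strict Implicit.
Unset Printing Implicit Defensive.

Local Open Scope classical_set_scope.
Local Open Scope ring_scope.

(** Write eta for the Young integral g1 dg2. Its coboundary mu = delta eta
    behaves like a measure on triangles: it is alternating, exactly additive
    under subdivision, and of size B diam^beta. So f d(eta) is a Riemann
    integral of f against mu, computed as the limit of the sums of
    f(first vertex) mu(piece) over the subdivisions of a triangle into 4^n
    similar triangles; in the same way eta is the limit of the sums of
    g1 (delta g2) over the bisections of a segment.

    Everything rests on one contraction. If a function of simplices is
    O(diam^gamma), then its sum over N pieces of half the diameter is O(diam^gamma)
    with the constant multiplied by q = N 2^-gamma, and q < 1 for segments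
    (N = 2, gamma = beta > 1) and for triangles (N = 4,
    gamma = alpha + beta > 2). Hence
    - the sums converge ([refine_limit]);
    - a bounded function whose defect (its difference with the sum over the
      pieces) is at most C diam^gamma is itself at most
      C / (1 - q) diam^gamma ([refine_defect_bound]). This gives the
      estimate of the theorem for every regular germ at finite distance from
      f mu, because regular germs are additive under subdivision, and the
      defect of f mu on a triangle is the sum of
      (f(p) - f(x_i)) mu(piece_i) = O(A B diam^gamma), where p and x_i are the
      first vertices of the triangle and of its pieces;
    - a bounded function equal to the sum over its pieces vanishes
      ([refine_fixed_eq0]). This is how all exact identities are proved;
    - the limit is continuous in the vertices ([refine_fixed_cvg]).

    The difficulty is the regularity of the limit, because subdivision gives
    additivity only for one way of cutting a triangle, while closedness on
    planes amounts to additivity for all of them. A discrepancy between two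
    ways of cutting the same figure is O(diam^gamma), so it vanishes as soon as
    it is the sum of the discrepancies of four half-size copies. One obtains in
    turn the reversal of orientation ([fan_swap12], [fan_swap23]), the
    additivity along rows of congruent parallelograms ([row_add]), the exchange
    of a triangle with an adjacent parallelogram ([trapezoid_shift]), and the
    cut of a triangle by a line through a vertex and a rational point of the
    opposite side ([tri_add]). Continuity then allows a real ratio
    ([surface_split]). Finally four coplanar points split into two pairs, both
    collinear with a common point of the hull (Radon), and the cocycle relation
    reduces closedness to cuts through that point ([alternating_affdep4]). *)

Local Notation edist := Pilot.Defs.edist.

(** * Functions reproduced by a contracting subdivision *)

Section SelfSimilar.
Variables (R : realType) (X : Type) (I : finType) (sub : I -> X -> X).
Variables (P : X -> Prop) (sz : X -> R) (g : R).
Hypothesis sub_stable : forall i x, P x -> P (sub i x).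
Hypothesis sz_ge0 : forall x, 0 <= sz x.
Hypothesis sz_sub : forall i x, P x -> sz (sub i x) <= sz x / 2.
Hypothesis g_gt0 : 0 < g.

Let q : R := #|I|%:R * 2^-1 `^ g.
Hypothesis q_lt1 : q < 1.

(** The subdivision operator: iterating it on a germ gives the Riemann sums
    over finer and finer subdivisions, and its fixed points are the germs that
    are additive under subdivision. *)
Definition refine (U : X -> R) (x : X) : R := \sum_i U (sub i x).

Let q_ge0 : 0 <= q.
Proof. by rewrite mulr_ge0 ?powR_ge0. Qed.

Let sz_powR_sub i x : P x -> sz (sub i x) `^ g <= 2^-1 `^ g * sz x `^ g.
Proof.
move=> Px; rewrite -powRM ?invr_ge0 //.
apply: ge0_ler_powR; rewrite ?nnegrE ?(ltW g_gt0) ?mulr_ge0 ?invr_ge0 //.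
by rewrite mulrC; exact: sz_sub.
Qed.

(** The contraction: each of the #|I| pieces has half the size, hence
    contributes a factor 2^-g. *)
Lemma refine_bound (U : X -> R) (C : R) : 0 <= C ->
  (forall x, P x -> `|U x| <= C * sz x `^ g) ->
  forall x, P x -> `|refine U x| <= q * C * sz x `^ g.
Proof.
move=> C0 HU x Px; apply: (le_trans (ler_norm_sum _ _ _)).
have -> : q * C * sz x `^ g = \sum_(i : I) C * (2^-1 `^ g * sz x `^ g).
  by rewrite sumr_const -[RHS]mulr_natl /q; set a := 2^-1 `^ g; ring.
apply: ler_sum => i _; apply: (le_trans (HU _ (sub_stable i Px))).
by apply: ler_wpM2l => //; exact: sz_powR_sub.
Qed.

Lemma iter_refine_bound (U : X -> R) (C : R) n : 0 <= C ->
  (forall x, P x -> `|U x| <= C * sz x `^ g) ->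
  forall x, P x -> `|iter n refine U x| <= q ^+ n * C * sz x `^ g.
Proof.
move=> C0 HU; elim: n => [|n IH] x Px; first by rewrite expr0 mul1r; exact: HU.
by rewrite iterS exprS -(mulrA q); apply: refine_bound => //;
  rewrite mulr_ge0 ?exprn_ge0.
Qed.

Lemma refineB U V x : refine (fun y => U y - V y) x = refine U x - refine V x.
Proof. by rewrite /refine sumrB. Qed.

Lemma iter_refineB U V n x :
  iter n refine (fun y => U y - V y) x = iter n refine U x - iter n refine V x.
Proof.
elim: n x => // n IH x.
by rewrite !iterS -refineB; apply: eq_bigr => i _; exact: IH.
Qed.

Lemma iter_refine_fixed U n : (forall x, P x -> refine U x = U x) ->
  forall x, P x -> iter n refine U x = U x.
Proof.
move=> HU; elim: n => // n IH x Px.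
rewrite iterS -[RHS]HU //; apply: eq_bigr => i _.
by apply: IH; exact: sub_stable.
Qed.

(** [U] is fixed, so its distance to the [n]-th Riemann sum of [w] is the
    [n]-th Riemann sum of [U - w], and each step contracts by [q]. *)
Lemma refine_rate (U w : X -> R) (C : R) n : 0 <= C ->
  (forall x, P x -> refine U x = U x) ->
  (forall x, P x -> `|U x - w x| <= C * sz x `^ g) ->
  forall x, P x -> `|U x - iter n refine w x| <= q ^+ n * C * sz x `^ g.
Proof.
move=> C0 HU Hw x Px.
rewrite -{1}(iter_refine_fixed n HU Px) -iter_refineB.
exact: iter_refine_bound.
Qed.

Let expq_cvg0 : (fun n => q ^+ n) @ \oo --> (0 : R).
Proof. by apply: cvg_expr; rewrite ger0_norm. Qed.

(** A bound with constant K improves to q K + C; iterating from any finite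
    constant M leads to the fixed point C / (1 - q), in which M has
    disappeared. *)
Lemma refine_defect_bound (U : X -> R) (M C : R) : 0 <= M -> 0 <= C ->
  (forall x, P x -> `|U x| <= M * sz x `^ g) ->
  (forall x, P x -> `|U x - refine U x| <= C * sz x `^ g) ->
  forall x, P x -> `|U x| <= C / (1 - q) * sz x `^ g.
Proof.
move=> M0 C0 HM HC.
have q1 : 0 < 1 - q by rewrite subr_gt0.
have HnX n : forall x, P x ->
    `|U x| <= (q ^+ n * M + C / (1 - q)) * sz x `^ g.
  elim: n => [|n IH] x Px.
    rewrite expr0 mul1r; apply: (le_trans (HM _ Px)).
    by rewrite ler_wpM2r ?powR_ge0 // lerDl divr_ge0 // ltW.
  rewrite -[U x](subrK (refine U x)); apply: (le_trans (ler_normD _ _)).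
  have K0 : 0 <= q ^+ n * M + C / (1 - q).
    by rewrite addr_ge0 ?mulr_ge0 ?exprn_ge0 ?invr_ge0 // ltW.
  apply: (le_trans (lerD (HC _ Px) (refine_bound K0 IH Px))).
  rewrite -mulrDl ler_wpM2r ?powR_ge0 // exprS le_eqVlt; apply/orP; left.
  by apply/eqP; field; exact: lt0r_neq0.
move=> x Px; apply: (@ler_cvg_to _ \oo _ _ (fun=> `|U x|)
  (fun n => (q ^+ n * M + C / (1 - q)) * sz x `^ g)).
- exact: cvg_cst.
- apply: cvgMr_tmp; rewrite -[X in _ --> X]add0r; apply: cvgD; last exact: cvg_cst.
  by rewrite -[0](mul0r M); apply: cvgMr_tmp; exact: expq_cvg0.
- by apply: nearW => n; exact: HnX.
Qed.

(** Rigidity: this is the tool for proving that two additive germs agree, or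
    that a germ has a symmetry. *)
Lemma refine_fixed_eq0 (U : X -> R) (M : R) : 0 <= M ->
  (forall x, P x -> `|U x| <= M * sz x `^ g) ->
  (forall x, P x -> refine U x = U x) ->
  forall x, P x -> U x = 0.
Proof.
move=> M0 HM HU x Px; apply/eqP; rewrite -normr_le0.
have := @refine_defect_bound U M 0 M0 (lexx _) HM _ x Px.
rewrite !mul0r; apply => y Py.
by rewrite HU // subrr normr0 mul0r.
Qed.

(** The sewing lemma. Consecutive Riemann sums differ by the iterated sum of
    the defect of [w], which decays geometrically. *)
Lemma refine_limit (w : X -> R) (C : R) : 0 <= C ->
  (forall x, P x -> `|w x - refine w x| <= C * sz x `^ g) ->
  exists U : X -> R, (forall x, P x -> refine U x = U x) /\
    (forall x, P x -> `|U x - w x| <= C / (1 - q) * sz x `^ g).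
Proof.
move=> C0 Hw.
have q1 : 0 < 1 - q by rewrite subr_gt0.
pose W n := iter n refine w.
have inc n x : P x -> `|W n.+1 x - W n x| <= C * sz x `^ g * q ^+ n.
  move=> Px; rewrite /W iterSr -iter_refineB.
  have -> : C * sz x `^ g * q ^+ n = q ^+ n * C * sz x `^ g by ring.
  by apply: iter_refine_bound => // y Py; rewrite distrC; exact: Hw.
have qn : `|q| < 1 by rewrite ger0_norm.
have cvW x : P x -> cvgn (fun n => W n x).
  move=> Px.
  have -> : (fun n => W n x) =
      (fun n => w x + series (fun k => W k.+1 x - W k x) n).
    by apply/funext => n; rewrite /series /= telescope_sumr // /W /= addrC subrK.
  apply: is_cvgD; first exact: is_cvg_cst.
  apply: normed_cvg; apply: (@series_le_cvg _ _ (geometric (C * sz x `^ g) q)).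
  - by move=> n /=.
  - by move=> n /=; rewrite !mulr_ge0 ?powR_ge0 ?exprn_ge0.
  - by move=> n /=; exact: inc.
  - exact: is_cvg_geometric_series.
exists (fun x => limn (fun n => W n x)); split => x Px.
  symmetry; apply: cvg_lim => //.
  rewrite -(cvg_shiftS (fun n => W n x)).
  rewrite /W /=; under eq_fun do rewrite /refine.
  apply: cvg_big; first exact: add_continuous.
  by move=> i _; apply: cvW; exact: sub_stable.
apply: (@ler_cvg_to _ \oo _ _ (fun n => `|W n x - w x|)
  (fun n => C / (1 - q) * sz x `^ g)).
- by apply: cvg_norm; apply: cvgB; [exact: cvW|exact: cvg_cst].
- exact: cvg_cst.
apply: nearW => n.
have -> : W n x - w x = \sum_(0 <= k < n) (W k.+1 x - W k x).
  by rewrite telescope_sumr.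
apply: (le_trans (ler_norm_sum _ _ _)).
apply: (@le_trans _ _ (\sum_(0 <= k < n) C * sz x `^ g * q ^+ k)).
  by apply: ler_sum => k _; exact: inc.
have -> : C / (1 - q) * sz x `^ g = C * sz x `^ g / (1 - q) by ring.
rewrite -mulr_sumr ler_wpM2l ?mulr_ge0 ?powR_ge0 //.
rewrite -[leRHS]mul1r ler_pdivlMr //.
have -> : (\sum_(0 <= k < n) q ^+ k) * (1 - q) = 1 - q ^+ n.
  by rewrite big_mkord; have := subrX1 q n; lra.
by rewrite gerBl exprn_ge0.
Qed.

(** Each Riemann sum of [w] inherits the sequential continuity of [w], and the
    convergence to [U] is uniform on configurations of bounded size. The
    predicate [Q] says that the configurations [xs j] tend to [x]. *)
Lemma refine_fixed_cvg (Q : (nat -> X) -> X -> Prop) (U w : X -> R) (C : R) :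
  0 <= C ->
  (forall xs x i, Q xs x -> Q (sub i \o xs) (sub i x)) ->
  (forall xs x, Q xs x -> P x /\ forall j, P (xs j)) ->
  (forall xs x, Q xs x -> exists B, forall j, sz (xs j) <= B) ->
  (forall xs x, Q xs x -> w \o xs @ \oo --> w x) ->
  (forall x, P x -> refine U x = U x) ->
  (forall x, P x -> `|U x - w x| <= C * sz x `^ g) ->
  forall xs x, Q xs x -> U \o xs @ \oo --> U x.
Proof.
move=> C0 Qsub QP Qsz Qw HU HC xs x Qx.
have [Px Pxs] := QP _ _ Qx.
have [B HB] := Qsz _ _ Qx.
have Qn n : forall ys y, Q ys y -> iter n refine w \o ys @ \oo --> iter n refine w y.
  elim: n => [|n IH] ys y Qy; first exact: Qw.
  rewrite iterS /refine /comp.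
  apply: cvg_big; first exact: add_continuous.
  by move=> i _; apply: (IH (sub i \o ys)); exact: Qsub.
have B0 : 0 <= B by apply: le_trans (HB 0%N).
pose M := C * B `^ g + C * sz x `^ g.
have HW n y : P y -> `|U y - iter n refine w y| <= q ^+ n * C * sz y `^ g.
  by move=> Py; exact: refine_rate.
apply/cvgrPdist_lt => e e0.
have e2 : 0 < e / 2 by rewrite divr_gt0.
have qM : (fun n => q ^+ n * M) @ \oo --> (0 : R).
  by rewrite -[X in _ --> X](mul0r M); apply: cvgMr_tmp; exact: expq_cvg0.
have [n _ Hn] := cvgr_lt _ qM _ e2.
have {Hn} qnM : q ^+ n * M < e / 2 by apply: (Hn n) => /=.
move/cvgrPdist_lt : (Qn n _ _ Qx) => /(_ _ e2).
apply: filterS => j Hj /=.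
have -> : U x - U (xs j) = (U x - iter n refine w x)
   + (iter n refine w x - iter n refine w (xs j))
   + (iter n refine w (xs j) - U (xs j)) by ring.
rewrite [e]splitr.
apply: (le_lt_trans (ler_normD _ _)).
apply: (@le_lt_trans _ _ (q ^+ n * C * sz x `^ g
   + `|iter n refine w x - iter n refine w (xs j)| + q ^+ n * C * B `^ g)).
  apply: lerD; last first.
    rewrite distrC; apply: (le_trans (HW n _ (Pxs j))).
    rewrite ler_wpM2l ?mulr_ge0 ?exprn_ge0 //.
    by apply: ge0_ler_powR; rewrite ?nnegrE ?(ltW g_gt0).
  by apply: (le_trans (ler_normD _ _)); rewrite lerD2r; exact: HW.
move: qnM Hj => /=; rewrite /M mulrDr; lra.
Qed.
End SelfSimilar.

(** * Convex sets and rows of congruent pieces *)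

Lemma powR_mono (R : realType) (g x y : R) :
  0 <= g -> 0 <= x -> x <= y -> x `^ g <= y `^ g.
Proof.
by move=> g0 x0 xy; apply: ge0_ler_powR; rewrite ?nnegrE //; exact: le_trans xy.
Qed.

(** Equality of two affine expressions in row vectors, entry by entry. *)
Ltac vec_eq := apply/rowP => ?; rewrite !mxE; (by field).

Section Convex.
Variables (R : realType) (d : nat).
Local Notation E := 'rV[R]_d.

Definition convex_set (K : set E) :=
  forall p q (t : R), 0 <= t <= 1 -> K p -> K q -> K (p + t *: (q - p)).

Lemma convex_seg (K : set E) (t : R) p q z : convex_set K ->
  K p -> K q -> 0 <= t <= 1 -> z = p + t *: (q - p) -> K z.
Proof. by move=> cK Kp Kq t01 ->; exact: cK. Qed.

Lemma convex_ray (K : set E) (N s : R) b k z : convex_set K ->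
  K b -> K (b + N *: k) -> 0 <= s <= N -> z = b + s *: k -> K z.
Proof.
move=> cK Kb KN /andP[s0 sN] ->; have [N0|Npos] := eqVneq N 0.
  have -> : s = 0 by lra.
  by rewrite scale0r addr0.
have N0 : 0 < N by rewrite lt_neqAle eq_sym Npos (le_trans s0).
apply: (convex_seg (t := s / N) cK Kb KN); last by vec_eq.
by rewrite divr_ge0 ?(ltW N0) //= ler_pdivrMr // mul1r.
Qed.

(** The parallelogram with corner [a] and sides [u] and [v] has its vertices
    in [K]. *)
Definition par_in (K : set E) (a u v : E) :=
  [/\ K a, K (a + u), K (a + v) & K (a + u + v)].

Lemma convex_par (K : set E) (s t : R) a u v z : convex_set K ->
  par_in K a u v -> 0 <= s <= 1 -> 0 <= t <= 1 -> z = a + s *: u + t *: v -> K z.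
Proof.
move=> cK [Ka Ku Kv Kuv] s01 t01 ->.
have K1 : K (a + s *: u) by apply: (convex_seg cK Ka Ku s01); vec_eq.
have K2 : K (a + v + s *: u) by apply: (convex_seg cK Kv Kuv s01); vec_eq.
by apply: (convex_seg cK K1 K2 t01); vec_eq.
Qed.

End Convex.

Lemma sum_pairs (V : zmodType) (A : nat -> V) n :
  \sum_(i < n) (A i.*2 + A i.*2.+1) = \sum_(i < n) A i + \sum_(i < n) A (n + i)%N.
Proof.
have -> : \sum_(i < n) (A i.*2 + A i.*2.+1) = \sum_(i < n + n) A i.
  rewrite addnn; elim: n => [|n IH]; first by rewrite !big_ord0.
  by rewrite big_ord_recr doubleS 2!big_ord_recr /= IH addrA.
by rewrite big_split_ord.
Qed.

(** [L a u v] stands for the value of an additive quantity on the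
    parallelogram with corner [a] and sides [u] and [v]. Cutting it in halves in
    the direction [u], and in as many layers as there are indices [j] in the
    direction [v], is allowed; the goal is to cut it in an arbitrary number of
    equal parts in the direction [u]. Segments are the case of one layer
    with offset 0, true parallelograms the case of two layers. *)
Section Row.
Variables (R : realType) (d : nat).
Local Notation E := 'rV[R]_d.
Variables (K : set E) (cK : convex_set K).
Variables (J : finType) (c : J -> R) (L : E -> E -> E -> R) (g C : R).
Hypothesis c01 : forall j, 0 <= c j <= 2^-1.
Hypothesis g0 : 0 < g.
Hypothesis C0 : 0 <= C.
Hypothesis qlt : (#|J| * 2)%:R * 2^-1 `^ g < 1 :> R.
Hypothesis L_halves : forall a u v, par_in K a u v ->
  L a u v = \sum_j (L (a + c j *: v) (2^-1 *: u) (2^-1 *: v)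
                  + L (a + c j *: v + 2^-1 *: u) (2^-1 *: u) (2^-1 *: v)).
Hypothesis L_defect : forall a u v (m n : nat),
  par_in K a ((m + n)%:R *: u) v ->
  `|L a ((m + n)%:R *: u) v - L a (m%:R *: u) v
    - L (a + m%:R *: u) (n%:R *: u) v|
  <= C * (`|(m + n)%:R *: u| + `|v|) `^ g.

Lemma par_in_row a u v (i n N : nat) : (i + n <= N)%N ->
  par_in K a (N%:R *: u) v -> par_in K (a + i%:R *: u) (n%:R *: u) v.
Proof.
move=> inN H; have [N0|Npos] := posnP N.
  move: inN H; rewrite N0 leqn0 addn_eq0 => /andP[/eqP -> /eqP ->].
  by rewrite !scale0r !addr0.
have Nn0 : N%:R != 0 :> R by rewrite pnatr_eq0 -lt0n.
have frac (k : nat) : (k <= N)%N -> 0 <= (k%:R / N%:R : R) <= 1.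
  move=> kN; rewrite divr_ge0 //= ler_pdivrMr ?ltr0n // mul1r.
  by rewrite ler_nat.
have i01 := frac i (leq_trans (leq_addr _ _) inN).
have j01 := frac _ inN.
by split; [apply: (convex_par (t := 0) cK H i01)
  |apply: (convex_par (t := 0) cK H j01)
  |apply: (convex_par (t := 1) cK H i01)
  |apply: (convex_par (t := 1) cK H j01)]; rewrite ?lexx ?ler01 //; vec_eq.
Qed.

(** Let F be the difference of the two sides. Halving all [n] pieces of a
    row produces [2 n] pieces of half the width, which regroup as two rows of
    [n] pieces, one for each half of the big parallelogram. So F is additive
    under halving, and it vanishes by rigidity. *)
Lemma row_sum (n : nat) a u v : par_in K a (n%:R *: u) v ->
  L a (n%:R *: u) v = \sum_(i < n) L (a + i%:R *: u) u v.
Proof.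
pose sub (ib : J * bool) (x : E * E * E) : E * E * E :=
  (x.1.1 + c ib.1 *: x.2 + (if ib.2 then 2^-1 else 0) *: (n%:R *: x.1.2),
   2^-1 *: x.1.2, 2^-1 *: x.2).
pose P (x : E * E * E) := par_in K x.1.1 (n%:R *: x.1.2) x.2.
pose sz (x : E * E * E) : R := `|n%:R *: x.1.2| + `|x.2|.
pose F (x : E * E * E) : R := L x.1.1 (n%:R *: x.1.2) x.2
  - \sum_(i < n) L (x.1.1 + i%:R *: x.1.2) x.1.2 x.2.
move=> Pauv; apply/eqP; rewrite -subr_eq0; apply/eqP.
rewrite -/(F (a, u, v)).
have c2 j : 0 <= c j + 2^-1 <= 1.
  by have /andP[h1 h2] := c01 j; apply/andP; split; lra.
have c1 j : 0 <= c j <= 1.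
  by have /andP[h1 h2] := c01 j; apply/andP; split; lra.
have half01 : 0 <= (2^-1 : R) <= 1 by apply/andP; split; lra.
apply: (@refine_fixed_eq0 R _ _ sub P sz g _ _ _ g0 _ F (n.+1%:R * C)) => //.
- move=> [j b] [[a' u'] v']; rewrite /P /sub /= => H.
  by case: b; split; [apply: (convex_par (s := 2^-1) (t := c j) cK H)
    |apply: (convex_par (s := 1) (t := c j) cK H)
    |apply: (convex_par (s := 2^-1) (t := c j + 2^-1) cK H)
    |apply: (convex_par (s := 1) (t := c j + 2^-1) cK H)
    |apply: (convex_par (s := 0) (t := c j) cK H)
    |apply: (convex_par (s := 2^-1) (t := c j) cK H)
    |apply: (convex_par (s := 0) (t := c j + 2^-1) cK H)
    |apply: (convex_par (s := 2^-1) (t := c j + 2^-1) cK H)];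
    rewrite ?lexx ?ler01 //; vec_eq.
- by move=> x; rewrite /sz addr_ge0.
- move=> ib [[a' u'] v'] _; rewrite /sz /sub /=.
  rewrite scalerA mulrC -scalerA !(normrZ 2^-1) ger0_norm ?invr_ge0 //.
  by rewrite mulrDl !(mulrC 2^-1).
- by rewrite card_prod card_bool.
- by rewrite mulr_ge0.
- move=> [[a' u'] v']; rewrite /P /F /sz /= => {Pauv}.
  elim: n {sub P sz F} => [|n IH] H.
    rewrite big_ord0 subr0 mul1r.
    (* The empty row: what is left is the value on a degenerate parallelogram. *)
    have := @L_defect a' u' v' 0 0; rewrite addn0 => /(_ H).
    by rewrite subrr sub0r normrN scale0r addr0.
  have H1 := par_in_row (i := 0) (n := n) (N := n.+1) (leqnSn n) H.
  rewrite scale0r addr0 in H1.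
  have := @L_defect a' u' v' n 1; rewrite addn1 => /(_ H) Hd.
  have := IH H1 => {}IH.
  rewrite big_ord_recr /= scale1r in Hd *.
  have -> : L a' (n.+1%:R *: u') v' - (\sum_(i < n) L (a' + i%:R *: u') u' v'
      + L (a' + n%:R *: u') u' v') = (L a' (n.+1%:R *: u') v'
      - L a' (n%:R *: u') v' - L (a' + n%:R *: u') u' v')
      + (L a' (n%:R *: u') v' - \sum_(i < n) L (a' + i%:R *: u') u' v') by ring.
  apply: (le_trans (ler_normD _ _)); apply: (le_trans (lerD Hd IH)).
  rewrite -[n.+2]add1n natrD mulrDl mul1r mulrDl lerD2l.
  rewrite ler_wpM2l ?mulr_ge0 // powR_mono ?(ltW g0) ?addr_ge0 //.
  by rewrite lerD2r !normrZ ler_wpM2r // !ger0_norm // ler_nat.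
- move=> [[a' u'] v']; rewrite /P /F /sub /refine /= => H.
  rewrite L_halves //.
  under [X in _ = _ - X]eq_bigr => i _.
    rewrite L_halves; last first.
      have := par_in_row (i := i) (n := 1) (N := n) _ H.
      by rewrite scale1r addn1; apply; exact: ltn_ord.
    over.
  rewrite exchange_big -sumrB //=.
  rewrite (eq_bigr (fun ib : J * bool => (fun j b => L
     (a' + c j *: v' + (if b then 2^-1 else 0) *: (n%:R *: u'))
     (n%:R *: (2^-1 *: u')) (2^-1 *: v') - \sum_(i < n) L (a' + c j *: v'
     + (if b then 2^-1 else 0) *: (n%:R *: u') + i%:R *: (2^-1 *: u'))
     (2^-1 *: u') (2^-1 *: v')) ib.1 ib.2)); last by [].
  rewrite -(pair_bigA _ (fun j b => L
     (a' + c j *: v' + (if b then 2^-1 else 0) *: (n%:R *: u'))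
     (n%:R *: (2^-1 *: u')) (2^-1 *: v') - \sum_(i < n) L (a' + c j *: v'
     + (if b then 2^-1 else 0) *: (n%:R *: u') + i%:R *: (2^-1 *: u'))
     (2^-1 *: u') (2^-1 *: v'))) //=.
  apply: eq_bigr => j _ //.
  rewrite big_bool /= scale0r addr0 //.
  pose A (k : nat) := L (a' + c j *: v' + k%:R *: (2^-1 *: u'))
     (2^-1 *: u') (2^-1 *: v').
  have -> : \sum_(i < n) (L (a' + i%:R *: u' + c j *: v') (2^-1 *: u') (2^-1 *: v')
      + L (a' + i%:R *: u' + c j *: v' + 2^-1 *: u') (2^-1 *: u') (2^-1 *: v'))
      = \sum_(i < n) (A i.*2 + A i.*2.+1).
    apply: eq_bigr => i _; congr (L _ _ _ + L _ _ _); rewrite -muln2 ?mulrS natrM;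
      vec_eq.
  rewrite sum_pairs.
  have -> : n%:R *: (2^-1 *: u') = 2^-1 *: (n%:R *: u') by vec_eq.
  have -> : \sum_(i < n) A (n + i)%N = \sum_(i < n) L (a' + c j *: v'
      + 2^-1 *: (n%:R *: u') + i%:R *: (2^-1 *: u')) (2^-1 *: u') (2^-1 *: v').
    by apply: eq_bigr => i _; congr (L _ _ _); rewrite natrD; vec_eq.
  rewrite /A; ring.
Qed.

Lemma row_add (m n : nat) a u v : par_in K a ((m + n)%:R *: u) v ->
  L a ((m + n)%:R *: u) v = L a (m%:R *: u) v + L (a + m%:R *: u) (n%:R *: u) v.
Proof.
move=> H; have H1 := par_in_row (i := 0) (n := m) (leq_addr n m) H.
rewrite scale0r addr0 in H1.
have H2 := par_in_row (leqnn _) H.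
rewrite !row_sum // big_split_ord /=; congr (_ + _).
by apply: eq_bigr => i _; congr (L _ _ _); rewrite natrD; vec_eq.
Qed.

End Row.

(** * Cutting a triangle at a rational point *)

(** The ranges of coordinates needed to check that the points of the next
    two proofs lie in the convex set. *)
Lemma grid_ranges (R : realType) (M N : R) : 0 <= M -> 0 <= N ->
  let h : R := 2^-1 in
  [/\ [/\ 0 <= (0 : R) <= M + N, 0 <= (0 : R) <= N, 0 <= N <= M + N,
          0 <= N <= N & 0 <= M + N <= M + N],
      [/\ 0 <= h * N <= M + N, 0 <= h * N + h * (M + N) <= M + N,
          0 <= h * N <= N, 0 <= h * (M + N) <= M + N & 0 <= h * M <= M + N]
    & [/\ 0 <= M <= M + N, 0 <= h * M + N <= M + N
      & 0 <= h * M + h * (M + N) <= M + N]].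
Proof.
by move=> M0 N0 h; rewrite /h; split; [split|split|split]; apply/andP; split; lra.
Qed.

Lemma sum_bool2 (V : nmodType) (G : bool * bool -> V) :
  \sum_b G b = G (true, true) + G (true, false) + (G (false, true) + G (false, false)).
Proof.
rewrite (eq_bigr (fun b => G (b.1, b.2))); last by case.
by rewrite -(pair_bigA _ (fun b c => G (b, c))) /= !big_bool.
Qed.

(** [th] stands for a germ on the triangles of a convex set that is
    alternating and additive under the subdivision into four similar
    triangles, and whose coboundary is small. The bound on the coboundary is
    what makes the difference of any two ways of cutting a figure bounded, as
    rigidity requires. *)
Section Plane.
Variables (R : realType) (d : nat).
Local Notation E := 'rV[R]_d.

Definition mid (p q : E) : E := 2^-1 *: (p + q).

Lemma mid_in (K : set E) p q : convex_set K -> K p -> K q -> K (mid p q).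
Proof.
move=> cK Kp Kq; apply: (convex_seg (t := 2^-1) cK Kp Kq).
  by apply/andP; split; lra.
by rewrite /mid; vec_eq.
Qed.

Variables (K : set E) (cK : convex_set K).
Variables (th : E -> E -> E -> R) (g C : R).
Hypothesis g0 : 0 < g.
Hypothesis C0 : 0 <= C.
Hypothesis qlt : 4 * 2^-1 `^ g < 1 :> R.
Hypothesis th_swap12 : forall p q r, K p -> K q -> K r -> th q p r = - th p q r.
Hypothesis th_swap23 : forall p q r, K p -> K q -> K r -> th p r q = - th p q r.
Hypothesis th_line : forall p q (t : R), K p -> K q -> 0 <= t <= 1 ->
  th p (p + t *: (q - p)) q = 0.
Hypothesis th_quarters : forall p q r, K p -> K q -> K r ->
  th p q r = th p (mid p q) (mid p r) + th (mid p q) q (mid q r)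
           + th (mid p r) (mid q r) r + th (mid q r) (mid p r) (mid p q).
Hypothesis th_bound : forall z p q r s M, K p -> K q -> K r -> K s ->
  `|p - z| <= M -> `|q - z| <= M -> `|r - z| <= M -> `|s - z| <= M ->
  `|th q r s - th p r s + th p q s - th p q r| <= C * M `^ g.

Let tri a h u := th a (a + h) (a + u).
Let par a u v := th a (a + u) (a + u + v) + th a (a + u + v) (a + v).

Let th_rot p q r : K p -> K q -> K r -> th q r p = th p q r.
Proof. by move=> Kp Kq Kr; rewrite th_swap23 // th_swap12 // opprK. Qed.

Let half01 : 0 <= (2^-1 : R) <= 1.
Proof. by apply/andP; split; lra. Qed.

Let in01 := (lexx (0 : R), @ler01 R, lexx (1 : R)).

(** Cutting both triangles of a parallelogram into four gives the eight
    halves of four parallelograms; only the two middle triangles have to be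
    rotated. *)
Lemma par_halves a u v : par_in K a u v ->
  par a u v = \sum_(b : bool)
    (par (a + (if b then 2^-1 else 0) *: v) (2^-1 *: u) (2^-1 *: v)
   + par (a + (if b then 2^-1 else 0) *: v + 2^-1 *: u) (2^-1 *: u) (2^-1 *: v)).
Proof.
move=> H; have [Ka Ku Kv Kuv] := H.
pose Q (x y : R) := a + x *: u + y *: v.
have KQ x y : 0 <= x <= 1 -> 0 <= y <= 1 -> K (Q x y).
  by move=> x01 y01; exact: (convex_par cK H x01 y01).
rewrite big_bool /= scale0r addr0 /par.
rewrite (th_quarters Ka Ku Kuv) (th_quarters Ka Kuv Kv).
pose h : R := 2^-1.
transitivity (th (Q 0 0) (Q h 0) (Q h h) + th (Q h 0) (Q 1 0) (Q 1 h)
  + th (Q h h) (Q 1 h) (Q 1 1) + th (Q 1 h) (Q h h) (Q h 0)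
  + (th (Q 0 0) (Q h h) (Q 0 h) + th (Q h h) (Q 1 1) (Q h 1)
  + th (Q 0 h) (Q h 1) (Q 0 1) + th (Q h 1) (Q 0 h) (Q h h))).
  by congr (_ + _); congr (_ + _ + _ + _); congr (th _ _ _);
    rewrite /Q /mid /h; vec_eq.
transitivity (th (Q 0 h) (Q h h) (Q h 1) + th (Q 0 h) (Q h 1) (Q 0 1)
  + (th (Q h h) (Q 1 h) (Q 1 1) + th (Q h h) (Q 1 1) (Q h 1))
  + (th (Q 0 0) (Q h 0) (Q h h) + th (Q 0 0) (Q h h) (Q 0 h)
  + (th (Q h 0) (Q 1 0) (Q 1 h) + th (Q h 0) (Q 1 h) (Q h h)))); last first.
  by congr (_ + _); congr (_ + _); congr (_ + _); congr (th _ _ _);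
    rewrite /Q /mid /h; vec_eq.
have h0 : K (Q h 0) by apply: KQ; rewrite ?half01 ?in01.
have h1 : K (Q h 1) by apply: KQ; rewrite ?half01 ?in01.
have hh : K (Q h h) by apply: KQ; rewrite ?half01 ?in01.
have k0 : K (Q 0 h) by apply: KQ; rewrite ?half01 ?in01.
have k1 : K (Q 1 h) by apply: KQ; rewrite ?half01 ?in01.
rewrite -(th_rot h1 k0 hh) (th_rot h0 k1 hh); ring.
Qed.

(** The middle triangle and one of the corner triangles form a
    parallelogram. *)
Lemma tri_halves a h u : K a -> K (a + h) -> K (a + u) ->
  tri a h u = tri a (2^-1 *: h) (2^-1 *: u)
    + tri (a + 2^-1 *: u) (2^-1 *: h) (2^-1 *: u)
    + par (a + 2^-1 *: h) (2^-1 *: h) (2^-1 *: (u - h)).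
Proof.
move=> Ka Kh Ku; rewrite /tri /par (th_quarters Ka Kh Ku).
rewrite (th_rot (p := mid a (a + h)) (q := mid (a + h) (a + u))
  (r := mid a (a + u))); try exact: mid_in.
transitivity (th a (mid a (a + h)) (mid a (a + u))
  + th (mid a (a + u)) (mid (a + h) (a + u)) (a + u)
  + (th (mid a (a + h)) (a + h) (mid (a + h) (a + u))
  + th (mid a (a + h)) (mid (a + h) (a + u)) (mid a (a + u)))); first by ring.
by congr (_ + _ + (_ + _)); congr (th _ _ _); rewrite /mid; vec_eq.
Qed.

Lemma th_line_nat b k (i N : nat) : (i <= N)%N -> K b -> K (b + N%:R *: k) ->
  th b (b + i%:R *: k) (b + N%:R *: k) = 0.
Proof.
move=> iN Kb KN; have [N0|Npos] := posnP N.
  move: iN KN; rewrite N0 leqn0 => /eqP -> KN.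
  have := th_line Kb KN (t := 0); rewrite ?in01 => /(_ isT).
  by rewrite !scale0r addr0.
have Nn0 : N%:R != 0 :> R by rewrite pnatr_eq0 -lt0n.
have t01 : 0 <= (i%:R / N%:R : R) <= 1.
  by rewrite divr_ge0 //= ler_pdivrMr ?ltr0n // mul1r ler_nat.
by rewrite -[RHS](th_line Kb KN t01); congr (th _ _ _); vec_eq.
Qed.

(** With the points O, X, Y on the base and O', X', Y' above them, the
    discrepancy is a combination of the coboundaries on O X Y Y', O X' Y' O' and
    O X X' Y', the collinear triples contributing nothing. *)
Lemma par_defect a u v (m n : nat) : par_in K a ((m + n)%:R *: u) v ->
  `|par a ((m + n)%:R *: u) v - par a (m%:R *: u) v
    - par (a + m%:R *: u) (n%:R *: u) v|
  <= 3 * C * (`|(m + n)%:R *: u| + `|v|) `^ g.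
Proof.
move=> H; set M := (X in X `^ g).
have Nb (x : E) (i : nat) (b : bool) : (i <= m + n)%N ->
    x = a + i%:R *: u + b%:R *: v -> `|x - a| <= M.
  move=> imn ->; have -> : a + i%:R *: u + b%:R *: v - a = i%:R *: u + b%:R *: v.
    by vec_eq.
  apply: (le_trans (ler_normD _ _)); apply: lerD; rewrite !normrZ.
    by rewrite ler_wpM2r // !ger0_norm // ler_nat.
  by rewrite -[leRHS]mul1r ler_wpM2r // ger0_norm //; case: b; rewrite ?lexx ?ler01.
have Hm := par_in_row (R := R) cK (i := 0) (n := m) (leq_addr n m) H.
have Hn := par_in_row (R := R) cK (leqnn _) H.
rewrite scale0r addr0 in Hm.
have [KO KY KO' KY'] := H; have [_ KX _ KX'] := Hm.
have eam : a + m%:R *: u + n%:R *: u = a + (m + n)%:R *: u.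
  by rewrite natrD; vec_eq.
rewrite /par eam.
move: Nb KO KX KY KO' KX' KY'.
set pO := a; set pX := a + _ *: u; set pY := a + (m + n)%:R *: u.
set pO' := a + v; set pX' := pX + v; set pY' := pY + v => Nb KO KX KY KO' KX' KY'.
have NO : `|pO - a| <= M by apply: (Nb _ 0%N false) => //; rewrite /pO /=; vec_eq.
have NX : `|pX - a| <= M.
  by apply: (Nb _ m false);
    [exact: leq_addr|rewrite /pX /=; vec_eq].
have NY : `|pY - a| <= M.
  by apply: (Nb _ (m + n)%N false);
    [exact: leqnn|rewrite /pY /=; vec_eq].
have NO' : `|pO' - a| <= M by apply: (Nb _ 0%N true) => //; rewrite /pO' /=; vec_eq.
have NX' : `|pX' - a| <= M.
  by apply: (Nb _ m true);
    [exact: leq_addr|rewrite /pX' /pX /=; vec_eq].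
have NY' : `|pY' - a| <= M.
  by apply: (Nb _ (m + n)%N true);
    [exact: leqnn|rewrite /pY' /pY /=; vec_eq].
have lOXY : th pO pX pY = 0 by apply: th_line_nat => //; exact: leq_addr.
have lOXY' : th pO' pX' pY' = 0.
  have e (i : nat) : a + i%:R *: u + v = pO' + i%:R *: u by rewrite /pO'; vec_eq.
  rewrite /pX' /pY' /pX /pY !e; apply: th_line_nat => //; first exact: leq_addr.
  by rewrite -e.
have k1 := th_bound KO KX KY KY' NO NX NY NY'.
have k2 := th_bound KO KX' KY' KO' NO NX' NY' NO'.
have k3 := th_bound KO KX KX' KY' NO NX NX' NY'.
have r1 := th_rot KO' KX' KY'.
have s1 := th_swap23 KX KX' KY'.
move: k1 k2 k3; rewrite !ler_norml => /andP[a1 b1] /andP[a2 b2] /andP[a3 b3].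
by apply/andP; split; lra.
Qed.

Lemma par_add a u v (m n : nat) : par_in K a ((m + n)%:R *: u) v ->
  par a ((m + n)%:R *: u) v
    = par a (m%:R *: u) v + par (a + m%:R *: u) (n%:R *: u) v.
Proof.
apply: (@row_add R d K cK bool (fun b => if b then 2^-1 else 0) par g (3 * C)).
- by move=> b; apply/andP; case: b; split; lra.
- exact: g0.
- by rewrite mulr_ge0.
- by rewrite card_bool.
- exact: par_halves.
- exact: par_defect.
Qed.

(** In a trapezoid with base [e + h] and top [e], where e = n k and h = m k,
    the triangle can be cut off on the right or on the left. The difference of
    the two is additive over four half-size trapezoids, at [a], [a + e / 2] and
    one half level higher: in each of the two layers the small triangle moves
    past one parallelogram of width [e / 2] at a time, and the parallelograms
    left over in the bottom layer match by [par_add]. This last step needs [h] and [e] to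
    be commensurable. *)
Lemma trapezoid_shift (m n : nat) a k u :
  K a -> K (a + u) -> K (a + u + n%:R *: k) -> K (a + (m + n)%:R *: k) ->
  par a (n%:R *: k) u + tri (a + n%:R *: k) (m%:R *: k) u
  = tri a (m%:R *: k) u + par (a + m%:R *: k) (n%:R *: k) (u - m%:R *: k).
Proof.
move=> Ka Ku Kue Khe.
pose F (x : E * E * E) : R := par x.1.1 (n%:R *: x.1.2) x.2
  + tri (x.1.1 + n%:R *: x.1.2) (m%:R *: x.1.2) x.2
  - (tri x.1.1 (m%:R *: x.1.2) x.2
  + par (x.1.1 + m%:R *: x.1.2) (n%:R *: x.1.2) (x.2 - m%:R *: x.1.2)).
apply/eqP; rewrite -subr_eq0; apply/eqP; rewrite -/(F (a, k, u)).
pose sub (b : bool * bool) (x : E * E * E) : E * E * E :=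
  (x.1.1 + (if b.1 then 2^-1 else 0) *: (n%:R *: x.1.2)
    + (if b.2 then 2^-1 else 0) *: x.2, 2^-1 *: x.1.2, 2^-1 *: x.2).
pose P (x : E * E * E) := [/\ K x.1.1, K (x.1.1 + x.2),
  K (x.1.1 + x.2 + n%:R *: x.1.2) & K (x.1.1 + (m + n)%:R *: x.1.2)].
pose sz (x : E * E * E) : R := `|(m + n)%:R *: x.1.2| + `|x.2|.
pose M : R := m%:R; pose N : R := n%:R; pose h : R := 2^-1.
have [M0 N0] : 0 <= M /\ 0 <= N by [].
have eMN : (m + n)%:R = M + N by rewrite natrD.
have inside a' k' u' : P (a', k', u') -> let Q x y := a' + x *: k' + y *: u' in
   [/\ forall s z, 0 <= s <= M + N -> z = Q s 0 -> K z,
       forall s z, 0 <= s <= N -> z = Q s 1 -> K z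
     & forall s t z, 0 <= s <= M + N -> 0 <= t <= N ->
         z = Q (h * (s + t)) h -> K z].
  move=> [K1 K2 K3 K4] Q; rewrite /= in K1 K2 K3; rewrite /= eMN in K4.
  have H0 s z : 0 <= s <= M + N -> z = Q s 0 -> K z.
    by move=> s01 ->; apply: (convex_ray cK K1 K4 s01); rewrite /Q; vec_eq.
  have H1 s z : 0 <= s <= N -> z = Q s 1 -> K z.
    by move=> s01 ->; apply: (convex_ray cK K2 K3 s01); rewrite /Q; vec_eq.
  split => // s t z s01 t01 ->.
  apply: (convex_seg (t := h) cK (H0 s _ s01 erefl) (H1 t _ t01 erefl)) => //.
  by rewrite /Q /h; vec_eq.
have [[r0 r1 r2 r3 r4] [r5 r6 r7 r8 r9] [r10 r11 r12]] := grid_ranges M0 N0.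
apply: (@refine_fixed_eq0 R _ _ sub P sz g _ _ _ g0 _ F (3 * C)) => //.
- move=> b [[a' k'] u'] Px; have [I0 I1 Ih] := inside _ _ _ Px.
  case: b => [[] []]; rewrite /P /sub /= eMN; split.
  + apply: (Ih N 0) => //; rewrite /N /h; vec_eq.
  + apply: (I1 (h * N)) => //; rewrite /N /h; vec_eq.
  + apply: (I1 N) => //; rewrite /N /h; vec_eq.
  + apply: (Ih (M + N) N) => //; rewrite /M /N /h; vec_eq.
  + apply: (I0 (h * N)) => //; rewrite /N /h; vec_eq.
  + apply: (Ih N 0) => //; rewrite /N /h; vec_eq.
  + apply: (Ih N N) => //; rewrite /N /h; vec_eq.
  + apply: (I0 (h * N + h * (M + N))) => //; rewrite /M /N /h; vec_eq.
  + apply: (Ih 0 0) => //; rewrite /N /h; vec_eq.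
  + apply: (I1 0) => //; rewrite /N /h; vec_eq.
  + apply: (I1 (h * N)) => //; rewrite /N /h; vec_eq.
  + apply: (Ih (M + N) 0) => //; rewrite /M /N /h; vec_eq.
  + apply: (I0 0) => //; rewrite /N /h; vec_eq.
  + apply: (Ih 0 0) => //; rewrite /N /h; vec_eq.
  + apply: (Ih N 0) => //; rewrite /N /h; vec_eq.
  + apply: (I0 (h * (M + N))) => //; rewrite /M /N /h; vec_eq.
- by move=> x; rewrite /sz addr_ge0.
- move=> b [[a' k'] u'] _; rewrite /sz /sub /=.
  rewrite scalerA mulrC -scalerA !(normrZ 2^-1) ger0_norm ?invr_ge0 //.
  by rewrite mulrDl !(mulrC 2^-1).
- by rewrite card_prod card_bool.
- by rewrite mulr_ge0.
- move=> [[a' k'] u'] Px; rewrite /sz /F /=; set D := (X in X `^ g).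
  have [I0 I1 _] := inside _ _ _ Px.
  have Nb (x : E) (s : R) (b : bool) : 0 <= s <= M + N ->
      x = a' + s *: k' + b%:R *: u' -> `|x - a'| <= D.
    move=> /andP[s0 s1] ->.
    have -> : a' + s *: k' + b%:R *: u' - a' = s *: k' + b%:R *: u' by vec_eq.
    apply: (le_trans (ler_normD _ _)); apply: lerD; rewrite !normrZ.
      by rewrite eMN ler_wpM2r // !ger0_norm // addr_ge0.
    by rewrite -[leRHS]mul1r ler_wpM2r // ger0_norm //; case: b; rewrite ?lexx ?ler01.
  have [KO KU KV KF] := Px; rewrite /= in KO KU KV KF.
  have KP : K (a' + n%:R *: k') by apply: (I0 N) => //; rewrite /N; vec_eq.
  have KH : K (a' + m%:R *: k') by apply: (I0 M) => //; rewrite /M; vec_eq.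
  rewrite /par /tri.
  have -> : a' + n%:R *: k' + m%:R *: k' = a' + (m + n)%:R *: k'.
    by rewrite natrD; vec_eq.
  have -> : a' + m%:R *: k' + n%:R *: k' = a' + (m + n)%:R *: k'.
    by rewrite natrD; vec_eq.
  have -> : a' + n%:R *: k' + u' = a' + u' + n%:R *: k' by vec_eq.
  have -> : a' + (m + n)%:R *: k' + (u' - m%:R *: k') = a' + u' + n%:R *: k'.
    by rewrite natrD; vec_eq.
  have -> : a' + m%:R *: k' + (u' - m%:R *: k') = a' + u' by vec_eq.
  have NO : `|a' - a'| <= D by apply: (Nb _ 0 false) => //=; vec_eq.
  have NP : `|a' + n%:R *: k' - a'| <= D.
    by apply: (Nb _ N false) => //=; rewrite /N; vec_eq.
  have NH : `|a' + m%:R *: k' - a'| <= D.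
    by apply: (Nb _ M false) => //=; rewrite /M; vec_eq.
  have NF : `|a' + (m + n)%:R *: k' - a'| <= D.
    by apply: (Nb _ (M + N) false) => //=; rewrite eMN; vec_eq.
  have NU : `|a' + u' - a'| <= D by apply: (Nb _ 0 true) => //=; vec_eq.
  have NV : `|a' + u' + n%:R *: k' - a'| <= D.
    by apply: (Nb _ N true) => //=; rewrite /N; vec_eq.
  have lP := th_line_nat (leq_addl m n) KO KF.
  have lH := th_line_nat (leq_addr n m) KO KF.
  have k1 := th_bound KO KP KF KV NO NP NF NV.
  have k2 := th_bound KO KH KF KV NO NH NF NV.
  have k3 := th_bound KO KH KV KU NO NH NV NU.
  move: k1 k2 k3 lP lH.
  set t1 := th a' (a' + n%:R *: k') (a' + (m + n)%:R *: k').
  set t2 := th a' (a' + m%:R *: k') (a' + (m + n)%:R *: k').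
  rewrite !ler_norml => /andP[a1 b1] /andP[a2 b2] /andP[a3 b3] e1 e2.
  by apply/andP; split; lra.
- move=> [[a' k'] u'] Px; have [I0 I1 Ih] := inside _ _ _ Px.
  have [KO KU KV KF] := Px; rewrite /= in KO KU KV KF.
  pose Q x y := a' + x *: k' + y *: u'.
  pose p x y s t := par (Q x y) (s *: k') (t *: k' + h *: u').
  pose t x y s t := tri (Q x y) (s *: k') (t *: k' + h *: u').
  have e1 : par a' (n%:R *: k') u' = p 0 0 (h * N) 0 + p (h * N) 0 (h * N) 0
      + p 0 h (h * N) 0 + p (h * N) h (h * N) 0.
    rewrite par_halves; last first.
      split => //; first by apply: (I0 N) => //; rewrite /N; vec_eq.
      by move: KV; congr (K _); vec_eq.
    rewrite big_bool /= [LHS]addrC -[RHS]addrA.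
    by congr (_ + _ + (_ + _)); congr (par _ _ _); rewrite /Q /N /h; vec_eq.
  have e2 : par (a' + m%:R *: k') (n%:R *: k') (u' - m%:R *: k')
      = p M 0 (h * N) (- (h * M)) + p (M + h * N) 0 (h * N) (- (h * M))
      + p (h * M) h (h * N) (- (h * M)) + p (h * M + h * N) h (h * N) (- (h * M)).
    rewrite par_halves; last first.
      split; [apply: (I0 M)|apply: (I0 (M + N))|apply: (I1 0)|apply: (I1 N)] => //;
        rewrite /M /N; vec_eq.
    rewrite big_bool /= [LHS]addrC -[RHS]addrA.
    by congr (_ + _ + (_ + _)); congr (par _ _ _); rewrite /Q /M /N /h; vec_eq.
  have e3 : tri a' (m%:R *: k') u' = t 0 0 (h * M) 0 + t 0 h (h * M) 0
      + p (h * M) 0 (h * M) (- (h * M)).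
    rewrite tri_halves //; last by apply: (I0 M) => //; rewrite /M; vec_eq.
    by congr (_ + _ + _); [congr (tri _ _ _)|congr (tri _ _ _)|congr (par _ _ _)];
      rewrite /Q /M /h; vec_eq.
  have e4 : tri (a' + n%:R *: k') (m%:R *: k') u' = t N 0 (h * M) 0
      + t N h (h * M) 0 + p (N + h * M) 0 (h * M) (- (h * M)).
    rewrite tri_halves.
    - by congr (_ + _ + _); [congr (tri _ _ _)|congr (tri _ _ _)|congr (par _ _ _)];
        rewrite /Q /M /N /h; vec_eq.
    - by apply: (I0 N) => //; rewrite /N; vec_eq.
    - by apply: (I0 (M + N)) => //; rewrite /M /N; vec_eq.
    - by move: KV; congr (K _); vec_eq.
  have sF x y : F (Q x y, 2^-1 *: k', 2^-1 *: u') = p x y (h * N) 0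
      + t (x + h * N) y (h * M) 0
      - (t x y (h * M) 0 + p (x + h * M) y (h * N) (- (h * M))).
    rewrite /F /=; congr (_ + _ - (_ + _));
      [congr (par _ _ _)|congr (tri _ _ _)|congr (tri _ _ _)|congr (par _ _ _)];
      rewrite /Q /M /N /h; vec_eq.
  have subQ b c : sub (b, c) (a', k', u') =
      (Q (if b then h * N else 0) (if c then h else 0), 2^-1 *: k', 2^-1 *: u').
    by congr (_, _, _); rewrite /Q /N /h /=; case: b; case: c; vec_eq.
  have add x (i j : nat) :
      par_in K (Q x 0) ((i + j)%:R *: (2^-1 *: k')) (- (h * M) *: k' + h *: u') ->
      p x 0 (h * (i%:R + j%:R)) (- (h * M)) = p x 0 (h * i%:R) (- (h * M))
      + p (x + h * i%:R) 0 (h * j%:R) (- (h * M)).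
    move=> /par_add; rewrite /p => e.
    transitivity (par (Q x 0) ((i + j)%:R *: (2^-1 *: k')) (- (h * M) *: k' + h *: u')).
      by congr (par _ _ _); rewrite /h natrD; vec_eq.
    by rewrite e; congr (_ + _); congr (par _ _ _); rewrite /Q /h; vec_eq.
  have A1 := add (h * M) m (n + n)%N.
  have A2 := add (h * M) (n + n)%N m.
  have A3 := add (h * M) n n.
  have A4 := add M n n.
  have D1 : par_in K (Q (h * M) 0) ((m + (n + n))%:R *: (2^-1 *: k'))
      (- (h * M) *: k' + h *: u').
    split; [apply: (I0 (h * M))|apply: (I0 (M + N))|apply: (Ih 0 0)
      |apply: (Ih (M + N) N)] => //; rewrite /Q ?natrD -/M -/N /h; vec_eq.
  have D2 := D1; rewrite addnC in D2.
  have D3 : par_in K (Q (h * M) 0) ((n + n)%:R *: (2^-1 *: k'))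
      (- (h * M) *: k' + h *: u').
    split; [apply: (I0 (h * M))|apply: (I0 (h * M + N))|apply: (Ih 0 0)
      |apply: (Ih N N)] => //; rewrite /Q ?natrD -/M -/N /h; vec_eq.
  have D4 : par_in K (Q M 0) ((n + n)%:R *: (2^-1 *: k'))
      (- (h * M) *: k' + h *: u').
    split; [apply: (I0 M)|apply: (I0 (M + N))|apply: (Ih M 0)
      |apply: (Ih (M + N) N)] => //; rewrite /Q ?natrD -/M -/N /h; vec_eq.
  move: (A1 D1) (A2 D2) (A3 D3) (A4 D4) => {A1 A2 A3 A4 D1 D2 D3 D4}.
  rewrite !natrD -/M -/N.
  have -> : h * (N + N + M) = h * (M + (N + N)) by ring.
  have -> : h * (N + N) = N by rewrite /h; field.
  have -> : h * M + h * M = M by rewrite /h; field.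
  have -> : h * M + N = N + h * M by ring.
  move=> A1 A2 A3 A4.
  rewrite /refine sum_bool2 !subQ !sF {1}/F /= e1 e2 e3 e4 !add0r.
  have -> : h * N + h * N = N by rewrite /h; field.
  rewrite (addrC (h * N) (h * M)).
  lra.
Qed.

(** Cutting off half the height of a triangle on the base [h] leaves, in the
    bottom layer, a triangle of half the size and a parallelogram. Comparing
    the whole triangle with its two parts, the upper halves form a cut of
    the same kind, the lower triangles also, and what remains is an instance of
    [trapezoid_shift]. So the discrepancy is the sum of only two half-size
    discrepancies. *)
Lemma tri_add (m n : nat) a k u :
  K a -> K (a + (m + n)%:R *: k) -> K (a + u) ->
  tri a ((m + n)%:R *: k) u = tri a (m%:R *: k) u
    + tri (a + m%:R *: k) (n%:R *: k) (u - m%:R *: k).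
Proof.
move=> Ka Kr Ku.
pose F (x : E * E * E) : R := tri x.1.1 ((m + n)%:R *: x.1.2) x.2
  - (tri x.1.1 (m%:R *: x.1.2) x.2
  + tri (x.1.1 + m%:R *: x.1.2) (n%:R *: x.1.2) (x.2 - m%:R *: x.1.2)).
apply/eqP; rewrite -subr_eq0; apply/eqP; rewrite -/(F (a, k, u)).
pose sub (b : bool) (x : E * E * E) : E * E * E :=
  (x.1.1 + (if b then 2^-1 else 0) *: x.2, 2^-1 *: x.1.2, 2^-1 *: x.2).
pose P (x : E * E * E) :=
  [/\ K x.1.1, K (x.1.1 + (m + n)%:R *: x.1.2) & K (x.1.1 + x.2)].
pose sz (x : E * E * E) : R := `|(m + n)%:R *: x.1.2| + `|x.2|.
pose M : R := m%:R; pose N : R := n%:R; pose h : R := 2^-1.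
have [M0 N0] : 0 <= M /\ 0 <= N by [].
have eMN : (m + n)%:R = M + N by rewrite natrD.
have inside a' k' u' : P (a', k', u') ->
   [/\ forall s z, 0 <= s <= M + N -> z = a' + s *: k' + 0 *: u' -> K z
     & forall s z, 0 <= s <= M + N -> z = a' + (h * s) *: k' + h *: u' -> K z].
  move=> [K1 K2 K3]; rewrite /= in K1 K3; rewrite /= eMN in K2.
  have H0 s z : 0 <= s <= M + N -> z = a' + s *: k' + 0 *: u' -> K z.
    by move=> s01 ->; apply: (convex_ray cK K1 K2 s01); vec_eq.
  split => // s z s01 ->.
  apply: (convex_seg (t := h) cK (H0 s _ s01 erefl) K3) => //.
  by rewrite /h; vec_eq.
have [[r0 _ r2 r3 r4] [r5 r6 r7 r8 r9] [r10 r11 r12]] := grid_ranges M0 N0.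
have q2 : #|{: bool}|%:R * 2^-1 `^ g < 1 :> R.
  apply: le_lt_trans qlt; rewrite card_bool ler_wpM2r ?powR_ge0 //.
  by rewrite ler_nat.
apply: (@refine_fixed_eq0 R _ _ sub P sz g _ _ _ g0 q2 F C) => //.
- move=> b [[a' k'] u'] Px; have [I0 Ih] := inside _ _ _ Px.
  have [KO KF KU] := Px; rewrite /= in KO KF KU.
  case: b; rewrite /P /sub /= eMN; split.
  + apply: (Ih 0) => //; rewrite /h; vec_eq.
  + apply: (Ih (M + N)) => //; rewrite /h; vec_eq.
  + by move: KU; congr (K _); vec_eq.
  + apply: (I0 0) => //; vec_eq.
  + apply: (I0 (h * (M + N))) => //; rewrite /h; vec_eq.
  + apply: (Ih 0) => //; rewrite /h; vec_eq.
- by move=> x; rewrite /sz addr_ge0.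
- move=> b [[a' k'] u'] _; rewrite /sz /sub /=.
  rewrite scalerA mulrC -scalerA !(normrZ 2^-1) ger0_norm ?invr_ge0 //.
  by rewrite mulrDl !(mulrC 2^-1).
- move=> [[a' k'] u'] Px; rewrite /sz /F /=; set D := (X in X `^ g).
  have [I0 _] := inside _ _ _ Px.
  have [KO KF KU] := Px; rewrite /= in KO KF KU.
  have KH : K (a' + m%:R *: k') by apply: (I0 M) => //; rewrite /M; vec_eq.
  have NH : `|a' + m%:R *: k' - a'| <= D.
    rewrite addrAC subrr add0r; apply: (@le_trans _ _ `|(m + n)%:R *: k'|).
      by rewrite !normrZ ler_wpM2r // !ger0_norm // ler_nat leq_addr.
    by rewrite lerDl.
  have NF : `|a' + (m + n)%:R *: k' - a'| <= D.
    by rewrite addrAC subrr add0r lerDl.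
  have NU : `|a' + u' - a'| <= D by rewrite addrAC subrr add0r lerDr.
  have NO : `|a' - a'| <= D by rewrite subrr normr0 addr_ge0.
  have k1 := th_bound KO KH KF KU NO NH NF NU.
  have l1 := th_line_nat (leq_addr n m) KO KF.
  rewrite /tri.
  have -> : a' + m%:R *: k' + n%:R *: k' = a' + (m + n)%:R *: k'.
    by rewrite natrD; vec_eq.
  have -> : a' + m%:R *: k' + (u' - m%:R *: k') = a' + u' by vec_eq.
  move: k1; rewrite l1 -normrN; congr (`|_| <= _); ring.
- move=> [[a' k'] u'] Px; have [I0 Ih] := inside _ _ _ Px.
  have [KO KF KU] := Px; rewrite /= in KO KF KU.
  pose Q x y := a' + x *: k' + y *: u'.
  pose p x y s t := par (Q x y) (s *: k') (t *: k' + h *: u').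
  pose t x y s t := tri (Q x y) (s *: k') (t *: k' + h *: u').
  have KH : K (a' + m%:R *: k') by apply: (I0 M) => //; rewrite /M; vec_eq.
  have e1 : tri a' ((m + n)%:R *: k') u' = t 0 0 (h * (M + N)) 0
      + t 0 h (h * (M + N)) 0
      + p (h * (M + N)) 0 (h * (M + N)) (- (h * (M + N))).
    rewrite tri_halves // eMN.
    by congr (_ + _ + _); [congr (tri _ _ _)|congr (tri _ _ _)|congr (par _ _ _)];
      rewrite /Q /h; vec_eq.
  have e2 : tri a' (m%:R *: k') u' = t 0 0 (h * M) 0 + t 0 h (h * M) 0
      + p (h * M) 0 (h * M) (- (h * M)).
    rewrite tri_halves //.
    by congr (_ + _ + _); [congr (tri _ _ _)|congr (tri _ _ _)|congr (par _ _ _)];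
      rewrite /Q /M /h; vec_eq.
  have e3 : tri (a' + m%:R *: k') (n%:R *: k') (u' - m%:R *: k')
      = t M 0 (h * N) (- (h * M)) + t (h * M) h (h * N) (- (h * M))
      + p (M + h * N) 0 (h * N) (- (h * (M + N))).
    rewrite tri_halves //.
    - by congr (_ + _ + _); [congr (tri _ _ _)|congr (tri _ _ _)|congr (par _ _ _)];
        rewrite /Q /M /N /h; vec_eq.
    - by apply: (I0 (M + N)) => //; rewrite /M /N; vec_eq.
    - by move: KU; congr (K _); vec_eq.
  have sF y : F (Q 0 y, 2^-1 *: k', 2^-1 *: u') = t 0 y (h * (M + N)) 0
      - (t 0 y (h * M) 0 + t (h * M) y (h * N) (- (h * M))).
    rewrite /F /= eMN.
    by congr (_ - (_ + _)); congr (tri _ _ _); rewrite /Q /M /N /h; vec_eq.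
  have subQ b : sub b (a', k', u') =
      (Q 0 (if b then h else 0), 2^-1 *: k', 2^-1 *: u').
    by congr (_, _, _); rewrite /Q /h /=; case: b; vec_eq.
  have shift : p (h * M) 0 (h * M) (- (h * M)) + t M 0 (h * N) (- (h * M))
      = t (h * M) 0 (h * N) (- (h * M))
      + p (h * (M + N)) 0 (h * M) (- (h * (M + N))).
    have T : par (Q (h * M) 0) (m%:R *: (2^-1 *: k')) (- (h * M) *: k' + h *: u')
      + tri (Q (h * M) 0 + m%:R *: (2^-1 *: k')) (n%:R *: (2^-1 *: k'))
        (- (h * M) *: k' + h *: u')
      = tri (Q (h * M) 0) (n%:R *: (2^-1 *: k')) (- (h * M) *: k' + h *: u')
      + par (Q (h * M) 0 + n%:R *: (2^-1 *: k')) (m%:R *: (2^-1 *: k'))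
        (- (h * M) *: k' + h *: u' - n%:R *: (2^-1 *: k')).
      apply: trapezoid_shift.
      - by apply: (I0 (h * M)).
      - by apply: (Ih 0) => //; rewrite /Q; vec_eq.
      - by apply: (Ih M) => //; rewrite /Q /M /h; vec_eq.
      - by apply: (I0 (h * M + h * (M + N))) => //; rewrite /Q natrD /M /N /h; vec_eq.
    have E1 : p (h * M) 0 (h * M) (- (h * M)) =
        par (Q (h * M) 0) (m%:R *: (2^-1 *: k')) (- (h * M) *: k' + h *: u').
      by congr (par _ _ _); rewrite /M /h; vec_eq.
    have E2 : t M 0 (h * N) (- (h * M)) =
        tri (Q (h * M) 0 + m%:R *: (2^-1 *: k')) (n%:R *: (2^-1 *: k'))
        (- (h * M) *: k' + h *: u').
      by congr (tri _ _ _); rewrite /Q /M /N /h; vec_eq.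
    have E3 : t (h * M) 0 (h * N) (- (h * M)) =
        tri (Q (h * M) 0) (n%:R *: (2^-1 *: k')) (- (h * M) *: k' + h *: u').
      by congr (tri _ _ _); rewrite /N /h; vec_eq.
    have E4 : p (h * (M + N)) 0 (h * M) (- (h * (M + N))) =
        par (Q (h * M) 0 + n%:R *: (2^-1 *: k')) (m%:R *: (2^-1 *: k'))
        (- (h * M) *: k' + h *: u' - n%:R *: (2^-1 *: k')).
      by congr (par _ _ _); rewrite /Q /M /N /h; vec_eq.
    by rewrite E1 E2 E3 E4.
  have add : p (h * (M + N)) 0 (h * (M + N)) (- (h * (M + N)))
      = p (h * (M + N)) 0 (h * M) (- (h * (M + N)))
      + p (M + h * N) 0 (h * N) (- (h * (M + N))).
    have T := @par_add (Q (h * (M + N)) 0) (2^-1 *: k')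
      (- (h * (M + N)) *: k' + h *: u') m n.
    transitivity (par (Q (h * (M + N)) 0) ((m + n)%:R *: (2^-1 *: k'))
      (- (h * (M + N)) *: k' + h *: u')).
      by congr (par _ _ _); rewrite eMN /h; vec_eq.
    rewrite T.
      by congr (_ + _); congr (par _ _ _); rewrite /Q /M /N /h; vec_eq.
    split; [apply: (I0 (h * (M + N)))|apply: (I0 (M + N))|apply: (Ih 0)
      |apply: (Ih (M + N))] => //; rewrite /Q ?eMN /h; vec_eq.
  rewrite /refine big_bool /= !subQ !sF {1}/F /= e1 e2 e3 add.
  move: shift; lra.
Qed.

End Plane.

(** * Additivity along a line *)

Lemma rat_approx (R : realType) (t : R) : 0 <= t <= 1 ->
  exists k : nat -> nat, (forall j, (k j <= j.+1)%N) /\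
    (fun j => (k j)%:R / j.+1%:R) @ \oo --> t.
Proof.
move=> /andP[t0 t1]; exists (fun j => Num.truncn (t * j.+1%:R)).
have x0 j : 0 <= t * j.+1%:R by rewrite mulr_ge0.
have lo j : (Num.truncn (t * j.+1%:R))%:R <= t * j.+1%:R.
  by have /andP[] := truncn_itv (x0 j).
have up j : t * j.+1%:R < (Num.truncn (t * j.+1%:R)).+1%:R.
  by have /andP[] := truncn_itv (x0 j).
split=> [j|].
  rewrite -(ler_nat R); apply: (le_trans (lo j)).
  by rewrite -[leRHS]mul1r ler_wpM2r.
apply/cvgrPdist_le => e e0.
have := @cvg_harmonic R => /cvgrPdist_le /(_ _ e0).
apply: filterS => j; rewrite sub0r normrN /harmonic /= => He.
apply: le_trans He; rewrite (ger0_norm (_ : 0 <= j.+1%:R^-1)) ?invr_ge0 //.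
have j0 : 0 < j.+1%:R :> R by rewrite ltr0n.
rewrite ger0_norm; last by rewrite subr_ge0 ler_pdivrMr.
rewrite -(ler_pM2r j0) mulVf ?lt0r_neq0 // mulrBl divfK ?lt0r_neq0 //.
by have := up j; rewrite -[_.+1%:R]natr1; lra.
Qed.

Section Between.
Variables (R : realType) (d : nat).
Local Notation E := 'rV[R]_d.

Definition between (p m r : E) := exists2 t : R, 0 <= t <= 1 & m = p + t *: (r - p).

(** Affine dependence of three points, that is, collinearity. Two of the
    coefficients suffice in the nonvanishing condition, the third being minus
    their sum. *)
Definition affdep3 (p q r : E) := exists a b c : R,
  [/\ a + b + c = 0, ~ (a = 0 /\ b = 0) & a *: p + b *: q + c *: r = 0].

(** When two coefficients of an affine relation have the same sign, the third
    point is the barycentre of the other two. *)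
Lemma same_sign_between (a b c : R) p q r :
  0 <= a * b -> a + b + c = 0 -> a + b != 0 ->
  a *: p + b *: q + c *: r = 0 -> between p r q.
Proof.
move=> ab0 s0 ab e; exists (b / (a + b)).
  have [sp|sn] := ltP 0 (a + b).
    by rewrite divr_ge0 ?(ltW sp) ?ler_pdivrMr // ?mul1r; [nra|nra].
  have {}sn : a + b < 0 by rewrite lt_neqAle ab.
  apply/andP; split; first by rewrite ler_ndivlMr // mul0r; nra.
  by rewrite ler_ndivrMr // mul1r; nra.
have ec : c = - (a + b) by lra.
have er : (a + b) *: r = a *: p + b *: q.
  move: e; rewrite ec scaleNr => /eqP; rewrite subr_eq0 => /eqP <-.
  by [].
have -> : r = (a + b)^-1 *: ((a + b) *: r) by rewrite scalerA mulVf // scale1r.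
by rewrite er; vec_eq.
Qed.

(** Among three real numbers two have the same weak sign. *)
Lemma affdep3_between p q r : affdep3 p q r ->
  between p r q \/ between q p r \/ between p q r.
Proof.
move=> [a [b [c [s0 nz e]]]].
have [ab|ab] := leP 0 (a * b).
  have [ab0|abn] := eqVneq (a + b) 0; first by exfalso; apply: nz; split; nra.
  by left; exact: (same_sign_between ab s0 abn e).
have [bc|bc] := leP 0 (b * c).
  right; left; apply: (same_sign_between (a := b) (b := c) (c := a) bc).
  - lra.
  - by apply/eqP => h; nra.
  - by rewrite -e; vec_eq.
right; right; apply: (same_sign_between (a := a) (b := c) (c := b)).
- nra.
- lra.
- by apply/eqP => h; nra.
- by rewrite -e; vec_eq.
Qed.

End Between.

(** [et] stands for a germ on the segments of a convex set that is
    antisymmetric and additive at midpoints, and whose coboundary is small. *)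
Section Line.
Variables (R : realType) (d : nat).
Local Notation E := 'rV[R]_d.
Variables (K : set E) (cK : convex_set K).
Variables (et : E -> E -> R) (g C : R).
Hypothesis g0 : 0 < g.
Hypothesis C0 : 0 <= C.
Hypothesis qlt : 2 * 2^-1 `^ g < 1 :> R.
Hypothesis et_swap : forall p q, K p -> K q -> et q p = - et p q.
Hypothesis et_mid : forall p q, K p -> K q ->
  et p q = et p (mid p q) + et (mid p q) q.
Hypothesis et_bound : forall z p q r M, K p -> K q -> K r ->
  `|p - z| <= M -> `|q - z| <= M -> `|r - z| <= M ->
  `|et q r - et p r + et p q| <= C * M `^ g.
Hypothesis et_cont : forall (ps qs : nat -> E) p q,
  (forall j, K (ps j)) -> (forall j, K (qs j)) -> K p -> K q ->
  ps @ \oo --> p -> qs @ \oo --> q ->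
  (fun j => et (ps j) (qs j)) @ \oo --> et p q.

Lemma line_add_nat (m n : nat) a k : K a -> K (a + (m + n)%:R *: k) ->
  et a (a + (m + n)%:R *: k) = et a (a + m%:R *: k)
    + et (a + m%:R *: k) (a + (m + n)%:R *: k).
Proof.
move=> Ka KF.
have qlt' : (#|{: unit}| * 2)%:R * 2^-1 `^ g < 1 :> R by rewrite card_unit.
have H := @row_add R d K cK _ (fun _ : unit => 0) (fun a u _ => et a (a + u)) g C.
rewrite (H _ g0 C0 qlt' _ _ m n a k 0); clear H.
- by rewrite natrD scalerDl addrA.
- by move=> _; rewrite lexx invr_ge0 ler0n.
- move=> b u v [Kb Ku _ _]; rewrite big_const card_unit /= addr0.
  rewrite (et_mid Kb Ku).
  by congr (et _ _ + et _ _); rewrite /mid; vec_eq.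
- move=> b u v i j [Kb Ku _ _].
  have seg (l : nat) : (l <= i + j)%N -> K (b + l%:R *: u) /\
      `|b + l%:R *: u - b| <= `|(i + j)%:R *: u| + `|v|.
    move=> lij; split.
      apply: (convex_ray cK Kb Ku (s := l%:R)) => //.
      by rewrite ler0n ler_nat.
    rewrite addrAC subrr add0r -[leLHS]addr0 lerD // !normrZ ler_wpM2r //.
    by rewrite !ger0_norm // ler_nat.
  have [Ki Ni] := seg _ (leq_addr j i).
  have [_ Nj] := seg _ (leqnn _).
  have N0 : `|b - b| <= `|(i + j)%:R *: u| + `|v|.
    by rewrite subrr normr0 addr_ge0.
  have := et_bound Kb Ki Ku N0 Ni Nj.
  have -> : b + i%:R *: u + j%:R *: u = b + (i + j)%:R *: u by rewrite natrD; vec_eq.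
  rewrite !ler_norml => /andP[h1 h2].
  by apply/andP; split; lra.
- by split; rewrite ?addr0.
Qed.

(** Rational ratios come from the division of the segment in equal parts,
    real ones by continuity. *)
Lemma line_split p q (t : R) : K p -> K q -> 0 <= t <= 1 ->
  et p q = et p (p + t *: (q - p)) + et (p + t *: (q - p)) q.
Proof.
move=> Kp Kq t01; have [k [kle kt]] := rat_approx t01.
pose ms j := p + ((k j)%:R / j.+1%:R) *: (q - p).
have frac01 j : 0 <= ((k j)%:R / j.+1%:R : R) <= 1.
  by rewrite divr_ge0 //= ler_pdivrMr ?ltr0n // mul1r ler_nat.
have Kms j : K (ms j) by exact: cK.
have Km : K (p + t *: (q - p)) by exact: cK.
have cms : ms @ \oo --> p + t *: (q - p).
  by apply: cvgD; [exact: cvg_cst|exact: cvgZr_tmp].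
have E1 : (fun j => et p (ms j) + et (ms j) q) = (fun=> et p q).
  apply/funext => j.
  have := @line_add_nat (k j) (j.+1 - k j) p (j.+1%:R^-1 *: (q - p)) Kp.
  rewrite subnKC // scalerA divff ?pnatr_eq0 // scale1r (addrC p (q - p)) subrK.
  by move=> /(_ Kq); rewrite scalerA => ->.
have : (fun j => et p (ms j) + et (ms j) q) @ \oo -->
    et p (p + t *: (q - p)) + et (p + t *: (q - p)) q.
  by apply: cvgD; apply: et_cont => //; exact: cvg_cst.
by rewrite E1 => /(cvg_lim (@Rhausdorff R)) <-; rewrite lim_cst.
Qed.

Lemma line_closed p q r : K p -> K q -> K r -> affdep3 p q r ->
  et q r - et p r + et p q = 0.
Proof.
move=> Kp Kq Kr /affdep3_between [|[|]] [t t01 e].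
- have := line_split Kp Kq t01; rewrite -e => h.
  by have := et_swap Kr Kq; lra.
- have := line_split Kq Kr t01; rewrite -e => h.
  by have := et_swap Kp Kq; lra.
- by have := line_split Kp Kr t01; rewrite -e; lra.
Qed.

End Line.

(** * Closedness on planes *)

(** An alternating germ that is additive when a triangle is cut by a line
    through a vertex is closed on planes. The coboundary [kappa] satisfies the
    cocycle identity, which allows a fifth point to be inserted. *)
Section Alternating.
Variables (R : realType) (d : nat).
Local Notation E := 'rV[R]_d.
Variables (K : set E) (cK : convex_set K).
Variables (th : E -> E -> E -> R).
Hypothesis th_swap12 : forall p q r, K p -> K q -> K r -> th q p r = - th p q r.
Hypothesis th_swap23 : forall p q r, K p -> K q -> K r -> th p r q = - th p q r.
Hypothesis th_split : forall p q r (t : R), K p -> K q -> K r -> 0 <= t <= 1 ->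
  th p r q = th p (p + t *: (r - p)) q + th (p + t *: (r - p)) r q.

Definition affdep4 (p q r s : E) := exists a b c e : R,
  [/\ a + b + c + e = 0, ~ [/\ a = 0, b = 0 & c = 0]
    & a *: p + b *: q + c *: r + e *: s = 0].

Let kappa p q r s := th q r s - th p r s + th p q s - th p q r.

Let th_between p m r q : K p -> K q -> K r -> between p m r ->
  th p r q = th p m q + th m r q.
Proof. by move=> Kp Kq Kr [t t01 ->]; exact: th_split. Qed.

Let th_aab p q : K p -> K q -> th p p q = 0.
Proof. by move=> Kp Kq; have := th_swap12 Kp Kp Kq; lra. Qed.

Let th_abb p q : K p -> K q -> th p q q = 0.
Proof. by move=> Kp Kq; have := th_swap23 Kp Kq Kq; lra. Qed.

Let th_between0 p m r : K p -> K m -> K r -> between p m r -> th p m r = 0.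
Proof.
move=> Kp Km Kr /(th_between Kp Km Kr) e.
have := th_swap23 Kp Km Kr; have := th_abb Kp Km.
have := th_swap23 Km Km Kr; have := th_aab Km Kr; lra.
Qed.

Lemma alternating_affdep3 p q r : K p -> K q -> K r -> affdep3 p q r -> th p q r = 0.
Proof.
move=> Kp Kq Kr /affdep3_between [|[|]] b.
- by have := th_between0 Kp Kr Kq b; have := th_swap23 Kp Kq Kr; lra.
- by have := th_between0 Kq Kp Kr b; have := th_swap12 Kp Kq Kr; lra.
- exact: th_between0.
Qed.

Let kappa_affdep3 p q r s : K p -> K q -> K r -> K s -> affdep3 p q r ->
  kappa p q r s = 0.
Proof.
move=> Kp Kq Kr Ks dpqr; rewrite /kappa (alternating_affdep3 Kp Kq Kr dpqr).
have := th_swap12 Kp Kq Ks; have := th_swap12 Kp Kr Ks.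
have := th_swap12 Kq Kr Ks.
move: dpqr => /affdep3_between [|[|]] b.
- by have := th_between Kp Ks Kq b; lra.
- by have := th_between Kq Ks Kr b; lra.
- by have := th_between Kp Ks Kr b; lra.
Qed.

(** In the cocycle identity for [p], [q], [r], [s], [m] each of the four other
    terms contains one of the collinear triples. *)
Let kappa_radon p q r s m : K p -> K q -> K r -> K s -> K m ->
  affdep3 p q m -> affdep3 r s m -> kappa p q r s = 0.
Proof.
move=> Kp Kq Kr Ks Km d1 d2.
have := kappa_affdep3 Kp Kq Km Kr d1; have := kappa_affdep3 Kp Kq Km Ks d1.
have := kappa_affdep3 Kr Ks Km Kp d2; have := kappa_affdep3 Kr Ks Km Kq d2.
rewrite /kappa (alternating_affdep3 Kp Kq Km d1) (alternating_affdep3 Kr Ks Km d2).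
have turn x y : K x -> K y -> th y m x = - th x m y.
  move=> Kx Ky; have := th_swap12 Kx Km Ky; have := th_swap23 Km Kx Ky.
  by have := th_swap12 Ky Km Kx; lra.
have rot x y z : K x -> K y -> K z -> th y z x = th x y z.
  by move=> Kx Ky Kz; rewrite th_swap23 // th_swap12 // opprK.
rewrite (turn _ _ Kq Kr) (turn _ _ Kp Kr) (turn _ _ Kq Ks) (turn _ _ Kp Ks).
rewrite (rot _ _ _ Kp Kr Ks) (rot _ _ _ Kq Kr Ks).
lra.
Qed.

(** The point of the segment from [p] to [q] with weights [a] and [b] is, by
    the affine relation, also on the line through [r] and [s]. *)
Let radon_point (a b c e : R) p q r s : K p -> K q ->
  a + b + c + e = 0 -> a *: p + b *: q + c *: r + e *: s = 0 ->
  0 <= a * b -> a + b != 0 -> exists m, [/\ K m, affdep3 p q m & affdep3 r s m].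
Proof.
move=> Kp Kq s0 e0 ab ab0.
exists (p + (b / (a + b)) *: (q - p)); split.
- apply: cK => //.
  have [sp|sn] := ltP 0 (a + b).
    by rewrite divr_ge0 ?(ltW sp) ?ler_pdivrMr // ?mul1r; nra.
  have {}sn : a + b < 0 by rewrite lt_neqAle ab0.
  apply/andP; split; first by rewrite ler_ndivlMr // mul0r; nra.
  by rewrite ler_ndivrMr // mul1r; nra.
- exists a, b, (- (a + b)); split; first by lra.
    by move=> [a0 b0]; move: ab0; rewrite a0 b0 addr0 eqxx.
  by vec_eq.
- exists c, e, (a + b); split; first by lra.
    by move=> [c0 e1]; move/eqP : ab0; apply; lra.
  by rewrite -e0; vec_eq.
Qed.

(** Some pair of coefficients has the same weak sign and a nonzero sum. Up to
    exchanging a pair with the complementary one there are three pairings, and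
    they are permuted by transpositions, under which the coboundary only
    changes sign. *)
Lemma alternating_affdep4 p q r s : K p -> K q -> K r -> K s -> affdep4 p q r s ->
  th q r s - th p r s + th p q s - th p q r = 0.
Proof.
move=> Kp Kq Kr Ks [a [b [c [e [s0 nz e0]]]]].
have pq : 0 <= a * b -> a + b != 0 -> kappa p q r s = 0.
  move=> h1 h2; have [m [Km d1 d2]] := radon_point Kp Kq s0 e0 h1 h2.
  exact: (kappa_radon Kp Kq Kr Ks Km d1 d2).
have pr : 0 <= a * c -> a + c != 0 -> kappa p q r s = 0.
  have s0' : a + c + b + e = 0 by lra.
  have e0' : a *: p + c *: r + b *: q + e *: s = 0 by rewrite -e0; vec_eq.
  move=> h1 h2; have [m [Km d1 d2]] := radon_point Kp Kr s0' e0' h1 h2.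
  have := kappa_radon Kp Kr Kq Ks Km d1 d2; rewrite /kappa.
  by rewrite (th_swap12 Kq Kr Ks) (th_swap23 Kp Kq Kr); lra.
have ps : 0 <= a * e -> a + e != 0 -> kappa p q r s = 0.
  have s0' : a + e + b + c = 0 by lra.
  have e0' : a *: p + e *: s + b *: q + c *: r = 0 by rewrite -e0; vec_eq.
  move=> h1 h2; have [m [Km d1 d2]] := radon_point Kp Ks s0' e0' h1 h2.
  have := kappa_radon Kp Ks Kq Kr Km d1 d2; rewrite /kappa.
  rewrite (th_swap12 Kq Ks Kr) (th_swap23 Kq Kr Ks) (th_swap23 Kp Kr Ks).
  by rewrite (th_swap23 Kp Kq Ks); lra.
have qr : 0 <= b * c -> b + c != 0 -> kappa p q r s = 0.
  have s0' : b + c + a + e = 0 by lra.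
  have e0' : b *: q + c *: r + a *: p + e *: s = 0 by rewrite -e0; vec_eq.
  move=> h1 h2; have [m [Km d1 d2]] := radon_point Kq Kr s0' e0' h1 h2.
  have := kappa_radon Kq Kr Kp Ks Km d1 d2; rewrite /kappa.
  rewrite (th_swap12 Kp Kr Ks) (th_swap12 Kp Kq Ks) (th_swap23 Kq Kp Kr).
  by rewrite (th_swap12 Kp Kq Kr); lra.
rewrite -/(kappa p q r s).
have [ab|ab] := leP 0 (a * b).
  have [ab0|] := eqVneq (a + b) 0; last exact: pq.
  have [a0 b0] : a = 0 /\ b = 0 by split; nra.
  apply: pr; first by rewrite a0 mul0r.
  by apply/eqP => c0; apply: nz; split => //; lra.
have sq (x y z : R) : x * y < 0 -> 0 <= x * z -> x + z != 0.
  move=> xy xz; apply/eqP => xz0.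
  have x0 : x != 0 by apply/eqP => x0; move: xy; rewrite x0 mul0r ltxx.
  have : 0 < x ^+ 2 by rewrite exprn_even_gt0.
  have -> : x ^+ 2 = - (x * z) by rewrite (_ : z = - x); [ring|lra].
  lra.
have [ac|ac] := leP 0 (a * c); first exact: pr (sq _ _ _ ab ac).
have [ae|ae] := leP 0 (a * e); first exact: ps (sq _ _ _ ab ae).
have bc : 0 <= b * c.
  have [a0|a0] := ltP 0 a.
    move: ab ac; rewrite !pmulr_rlt0 // => /ltW b0 /ltW c0.
    by rewrite mulr_le0.
  have {}a0 : a < 0.
    rewrite lt_neqAle a0 andbT; apply/eqP => a0'.
    by move: ab; rewrite a0' mul0r ltxx.
  by move: ab ac; rewrite !nmulr_rlt0 // => /ltW b0 /ltW c0; rewrite mulr_ge0.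
by apply: qr => //; apply: (sq _ a) => //; rewrite mulrC.
Qed.

End Alternating.

Section Surface.
Variables (R : realType) (d : nat).
Local Notation E := 'rV[R]_d.
Variables (K : set E) (cK : convex_set K).
Variables (th : E -> E -> E -> R) (g C : R).
Hypothesis g0 : 0 < g.
Hypothesis C0 : 0 <= C.
Hypothesis qlt : 4 * 2^-1 `^ g < 1 :> R.
Hypothesis th_swap12 : forall p q r, K p -> K q -> K r -> th q p r = - th p q r.
Hypothesis th_swap23 : forall p q r, K p -> K q -> K r -> th p r q = - th p q r.
Hypothesis th_line : forall p q (t : R), K p -> K q -> 0 <= t <= 1 ->
  th p (p + t *: (q - p)) q = 0.
Hypothesis th_quarters : forall p q r, K p -> K q -> K r ->
  th p q r = th p (mid p q) (mid p r) + th (mid p q) q (mid q r)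
           + th (mid p r) (mid q r) r + th (mid q r) (mid p r) (mid p q).
Hypothesis th_bound : forall z p q r s M, K p -> K q -> K r -> K s ->
  `|p - z| <= M -> `|q - z| <= M -> `|r - z| <= M -> `|s - z| <= M ->
  `|th q r s - th p r s + th p q s - th p q r| <= C * M `^ g.
Hypothesis th_cont : forall (ps qs rs : nat -> E) p q r,
  (forall j, K (ps j)) -> (forall j, K (qs j)) -> (forall j, K (rs j)) ->
  K p -> K q -> K r -> ps @ \oo --> p -> qs @ \oo --> q -> rs @ \oo --> r ->
  (fun j => th (ps j) (qs j) (rs j)) @ \oo --> th p q r.

Lemma surface_split p q r (t : R) : K p -> K q -> K r -> 0 <= t <= 1 ->
  th p r q = th p (p + t *: (r - p)) q + th (p + t *: (r - p)) r q.
Proof.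
move=> Kp Kq Kr t01; have [k [kle kt]] := rat_approx t01.
pose ms j := p + ((k j)%:R / j.+1%:R) *: (r - p).
have frac01 j : 0 <= ((k j)%:R / j.+1%:R : R) <= 1.
  by rewrite divr_ge0 //= ler_pdivrMr ?ltr0n // mul1r ler_nat.
have Kms j : K (ms j) by exact: cK.
have Km : K (p + t *: (r - p)) by exact: cK.
have cms : ms @ \oo --> p + t *: (r - p).
  by apply: cvgD; [exact: cvg_cst|exact: cvgZr_tmp].
have E1 : (fun j => th p (ms j) q + th (ms j) r q) = (fun=> th p r q).
  apply/funext => j.
  have jn0 : j.+1%:R != 0 :> R by rewrite pnatr_eq0.
  have T := tri_add cK g0 C0 qlt th_swap12 th_swap23 th_line th_quarters th_bound
    (m := k j) (n := (j.+1 - k j)%N) (a := p) (k := j.+1%:R^-1 *: (r - p))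
    (u := q - p) Kp.
  rewrite subnKC // in T.
  have er : p + j.+1%:R *: (j.+1%:R^-1 *: (r - p)) = r by vec_eq.
  have eq : p + (q - p) = q by vec_eq.
  rewrite er eq in T.
  have em : p + (k j)%:R *: (j.+1%:R^-1 *: (r - p)) = ms j by rewrite /ms; vec_eq.
  rewrite (T Kr Kq) em; congr (_ + th _ _ _); last by rewrite -em; vec_eq.
  rewrite natrB // -em; vec_eq.
have : (fun j => th p (ms j) q + th (ms j) r q) @ \oo -->
    th p (p + t *: (r - p)) q + th (p + t *: (r - p)) r q.
  by apply: cvgD; apply: th_cont => //; exact: cvg_cst.
by rewrite E1 => /(cvg_lim (@Rhausdorff R)) <-; rewrite lim_cst.
Qed.

Lemma surface_closed p q r s : K p -> K q -> K r -> K s -> affdep4 p q r s ->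
  th q r s - th p r s + th p q s - th p q r = 0.
Proof. exact: (alternating_affdep4 cK th_swap12 th_swap23 surface_split). Qed.

End Surface.

(** * The one-dimensional sewing *)

(** Halving the edges of an [n]-dimensional simplex gives 2^n pieces; the
    contraction factor is below 1 for exponents above the dimension. *)
Lemma half_powR_lt1 (R : realType) (n : nat) (g : R) :
  n%:R < g -> (2 ^ n)%:R * 2^-1 `^ g < 1.
Proof.
move=> ng; have -> : g = n%:R + (g - n%:R) by rewrite addrC subrK.
rewrite powRD; last by rewrite invr_eq0 pnatr_eq0 implybT.
rewrite powR_mulrn ?invr_ge0 // exprVn natrX mulrA divff ?mul1r ?expf_neq0 //.
rewrite -[ltRHS](congr1 (fun h => h (g - n%:R)) (powR1 R)).
by apply: gt0_ltr_powR; rewrite ?nnegrE ?subr_gt0 ?invr_ge0 // invf_lt1 // ltr1n.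
Qed.

Section Euclid.
Variables (R : realType) (d : nat).
Local Notation E := 'rV[R]_d.
Implicit Types p q x y : E.

Lemma edist_ge0 p q : 0 <= edist p q.
Proof. exact: sqrtr_ge0. Qed.

Lemma edistC p q : edist p q = edist q p.
Proof. by congr Num.sqrt; apply: eq_bigr => j _; rewrite -sqrrN opprB. Qed.

Lemma edistxx p : edist p p = 0.
Proof.
by rewrite /edist big1 ?sqrtr0 // => j _; rewrite subrr expr0n.
Qed.

Lemma edist_half x y p q : x - y = 2^-1 *: (p - q) -> edist x y = edist p q / 2.
Proof.
move=> e; rewrite /edist.
have -> : \sum_(j < d) (x 0 j - y 0 j) ^+ 2
    = 2^-1 ^+ 2 * \sum_(j < d) (p 0 j - q 0 j) ^+ 2.
  rewrite mulr_sumr; apply: eq_bigr => j _; rewrite -exprMn; congr (_ ^+ 2).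
  by move/(congr1 (fun v : E => v 0 j)) : e; rewrite !mxE.
by rewrite sqrtrM ?sqr_ge0 // sqrtr_sqr ger0_norm ?invr_ge0 // mulrC.
Qed.

Lemma edist_le_norm p q : edist p q <= d%:R * `|p - q|.
Proof.
rewrite /edist -[leRHS]ger0_norm ?mulr_ge0 // -sqrtr_sqr ler_wsqrtr //.
rewrite exprMn; apply: (@le_trans _ _ (\sum_(j < d) `|p - q| ^+ 2)).
  apply: ler_sum => j _; rewrite -real_normK ?num_real // lerXn2r ?nnegrE //.
  have -> : p 0 j - q 0 j = (p - q) 0 j by rewrite !mxE.
  rewrite {2}/Num.norm /= mx_normrE.
  exact: (@le_bigmax _ _ _ 0 (fun ij : 'I_1 * 'I_d => `|(p - q) ij.1 ij.2|) (0, j)).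
rewrite sumr_const card_ord -[leLHS]mulr_natl ler_wpM2r ?sqr_ge0 //.
by rewrite -natrX ler_nat; case: d => // n; rewrite leq_pmulr.
Qed.

Lemma edist_le_center z p q M : `|p - z| <= M -> `|q - z| <= M ->
  edist p q <= d%:R * 2 * M.
Proof.
move=> pz qz; apply: (le_trans (edist_le_norm p q)); rewrite -mulrA ler_wpM2l //.
have -> : p - q = (p - z) - (q - z) by vec_eq.
by apply: (le_trans (ler_normB _ _)); rewrite mulr2n mulrDl mul1r lerD.
Qed.

Lemma cvg_mid (ps qs : nat -> E) p q :
  ps @ \oo --> p -> qs @ \oo --> q -> (fun j => mid (ps j) (qs j)) @ \oo --> mid p q.
Proof. by move=> cp cq; apply: cvgZl_tmp; exact: cvgD. Qed.

End Euclid.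

(** Here and below, [et] is any germ that is additive at midpoints and close
    to g1 (delta g2); it is used both for the limit of the Riemann sums and for
    the chosen sewing. *)
Section Chord.
Variables (R : realType) (d : nat).
Local Notation E := 'rV[R]_d.

Definition chord_half (b : bool) (x : E * E) : E * E :=
  if b then (mid x.1 x.2, x.2) else (x.1, mid x.1 x.2).

Lemma edist_chord_half b (x : E * E) :
  edist (chord_half b x).1 (chord_half b x).2 = edist x.1 x.2 / 2.
Proof. by case: b => /=; apply: edist_half; rewrite /mid; vec_eq. Qed.

Lemma chord_half_le b (x : E * E) :
  edist (chord_half b x).1 (chord_half b x).2 <= edist x.1 x.2 / 2.
Proof. by rewrite edist_chord_half. Qed.

Lemma refine_chord (U : E * E -> R) (x : E * E) :
  refine chord_half U x = U (mid x.1 x.2, x.2) + U (x.1, mid x.1 x.2).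
Proof. by rewrite /refine big_bool. Qed.


Variables (K : set E) (cK : convex_set K).
Variables (et : E -> E -> R) (g1 g2 : E -> R) (b B C : R).
Hypothesis b1 : 1 < b.
Hypothesis B0 : 0 <= B.
Hypothesis C0 : 0 <= C.
Hypothesis et_mid : forall p q, K p -> K q ->
  et p q = et p (mid p q) + et (mid p q) q.
Hypothesis et_near : forall p q, K p -> K q ->
  `|et p q - g1 p * (g2 q - g2 p)| <= C * edist p q `^ b.
Hypothesis g_bound : forall p q r M, K p -> K q -> K r ->
  edist p q <= M -> edist q r <= M -> edist p r <= M ->
  `|(g1 q - g1 p) * (g2 r - g2 q)| <= B * M `^ b.
Hypothesis g1_cont : forall (ps : nat -> E) p, (forall j, K (ps j)) -> K p ->
  ps @ \oo --> p -> g1 \o ps @ \oo --> g1 p.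
Hypothesis g2_cont : forall (ps : nat -> E) p, (forall j, K (ps j)) -> K p ->
  ps @ \oo --> p -> g2 \o ps @ \oo --> g2 p.

Let b0 : 0 < b. Proof. exact: lt_trans b1. Qed.

Let q1 : 2 * 2^-1 `^ b < 1 :> R. Proof. exact: (@half_powR_lt1 R 1). Qed.

Let q1' : #|{: bool}|%:R * 2^-1 `^ b < 1 :> R.
Proof. by rewrite card_bool. Qed.

Let P (x : E * E) := K x.1 /\ K x.2.
Let sz (x : E * E) := edist x.1 x.2.

Let P_half (c : bool) x : P x -> P (chord_half c x).
Proof. by case: c => -[Kp Kq]; split => //=; exact: mid_in. Qed.

Let sz_half (c : bool) x : P x -> sz (chord_half c x) <= sz x / 2.
Proof. by move=> _; exact: chord_half_le. Qed.

Let sz0 x : 0 <= sz x. Proof. exact: edist_ge0. Qed.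

(** The sum of the values for the two orientations is additive at midpoints,
    and it is small because g1 (delta g2) on [p], [q] and on [q], [p] add up to
    a value of the cup product on the triple [p], [q], [p]. *)
Lemma chord_swap p q : K p -> K q -> et q p = - et p q.
Proof.
move=> Kp Kq; pose U (x : E * E) := et x.1 x.2 + et x.2 x.1.
suff : U (p, q) = 0 by rewrite /U /=; lra.
apply: (@refine_fixed_eq0 R _ _ chord_half P sz b P_half sz0 sz_half b0 q1' U
  (2 * C + B)) => //.
- by rewrite addr_ge0 ?mulr_ge0.
- move=> [x y] [/= Kx Ky]; rewrite /U /sz /=.
  have h1 := et_near Kx Ky; have h2 := et_near Ky Kx.
  have h3 := g_bound Kx Ky Kx (lexx _).
  rewrite (edistC y x) edistxx in h2 h3.
  have {h3} := h3 (lexx _) (edist_ge0 x y).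
  move: h1 h2; rewrite !ler_norml => /andP[a1 c1] /andP[a2 c2] /andP[a3 c3].
  by apply/andP; split; lra.
- move=> [x y] [/= Kx Ky]; rewrite refine_chord /U /=.
  have := et_mid Kx Ky; have := et_mid Ky Kx.
  have -> : mid y x = mid x y by rewrite /mid addrC.
  lra.
Qed.

Lemma chord_coboundary p q r M : K p -> K q -> K r ->
  edist p q <= M -> edist q r <= M -> edist p r <= M ->
  `|et q r - et p r + et p q| <= (3 * C + B) * M `^ b.
Proof.
move=> Kp Kq Kr pq qr pr.
have near x y : K x -> K y -> edist x y <= M ->
    `|et x y - g1 x * (g2 y - g2 x)| <= C * M `^ b.
  move=> Kx Ky xy; apply: (le_trans (et_near Kx Ky)).
  by rewrite ler_wpM2l // powR_mono ?edist_ge0 // ltW.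
have h1 := near _ _ Kp Kq pq; have h2 := near _ _ Kq Kr qr.
have h3 := near _ _ Kp Kr pr; have h4 := g_bound Kp Kq Kr pq qr pr.
move: h1 h2 h3 h4; rewrite !ler_norml.
move=> /andP[a1 c1] /andP[a2 c2] /andP[a3 c3] /andP[a4 c4].
by apply/andP; split; lra.
Qed.

Lemma chord_cont (ps qs : nat -> E) p q :
  (forall j, K (ps j)) -> (forall j, K (qs j)) -> K p -> K q ->
  ps @ \oo --> p -> qs @ \oo --> q ->
  (fun j => et (ps j) (qs j)) @ \oo --> et p q.
Proof.
move=> Kps Kqs Kp Kq cp cq.
pose Q (xs : nat -> E * E) (x : E * E) :=
  [/\ P x, forall j, P (xs j), exists M, forall j, sz (xs j) <= M,
    (fun j => (xs j).1) @ \oo --> x.1 & (fun j => (xs j).2) @ \oo --> x.2].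
apply: (@refine_fixed_cvg R _ _ chord_half P sz b P_half sz0 sz_half b0 q1' Q
  (fun x => et x.1 x.2) (fun x => g1 x.1 * (g2 x.2 - g2 x.1)) C C0 _ _ _ _ _ _
  (fun j => (ps j, qs j)) (p, q)).
- move=> xs x c [Px Pxs [M HM] c1 c2]; split.
  + exact: P_half.
  + by move=> j; exact: P_half.
  + exists (M / 2) => j; apply: (le_trans (sz_half c (Pxs j))).
    by rewrite ler_wpM2r.
  + by case: c => //=; exact: cvg_mid.
  + by case: c => //=; exact: cvg_mid.
- by move=> xs x [].
- by move=> xs x [].
- move=> xs x [[K1 K2] Pxs _ c1 c2].
  have Kxs1 j : K (xs j).1 by have [] := Pxs j.
  have Kxs2 j : K (xs j).2 by have [] := Pxs j.
  apply: cvgM; first exact: (g1_cont Kxs1).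
  by apply: cvgB; [exact: (g2_cont Kxs2)|exact: (g2_cont Kxs1)].
- by move=> [x y] [/= Kx Ky]; rewrite refine_chord /= addrC -et_mid.
- by move=> [x y] [/= Kx Ky]; exact: et_near.
- split; [by []|by move=> j; split; [exact: Kps|exact: Kqs]| |exact: cp|exact: cq].
  have /cvg_seq_bounded [M [_ HM]] : cvgn (fun j => ps j - qs j).
    by apply: is_cvgB; [apply: cvgP cp|apply: cvgP cq].
  exists (d%:R * (M + 1)) => j.
  apply: (@le_trans _ _ (d%:R * `|ps j - qs j|)); first exact: edist_le_norm.
  by rewrite ler_wpM2l //; apply: HM => //; rewrite ltrDl.
Qed.

Lemma chord_closed p q r : K p -> K q -> K r -> affdep3 p q r ->
  et q r - et p r + et p q = 0.
Proof.
pose c : R := (3 * C + B) * (d%:R * 2) `^ b.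
apply: (@line_closed R d K cK et b c b0 _ q1 chord_swap et_mid _ chord_cont).
  by rewrite mulr_ge0 ?powR_ge0 ?addr_ge0 ?mulr_ge0.
move=> z x y t M Kx Ky Kt xz yz tz; rewrite /c -mulrA -powRM //; first last.
  exact: le_trans xz.
by apply: chord_coboundary => //; apply: (edist_le_center (z := z)).
Qed.

End Chord.

(** * The two-dimensional sewing *)

Section Fan.
Variables (R : realType) (d : nat).
Local Notation E := 'rV[R]_d.

(** Vertices are ordered so that permuting the vertices of a triangle
    permutes those of its four pieces in the same way: the corner pieces are
    homothetic to the triangle, and in the middle piece each vertex is
    replaced by the midpoint of the opposite side. *)
Definition fan_quarter (c : bool * bool) (x : E * E * E) : E * E * E :=
  let: (p, q, r) := x in
  match c with
  | (false, false) => (p, mid p q, mid p r)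
  | (false, true) => (mid p q, q, mid q r)
  | (true, false) => (mid p r, mid q r, r)
  | (true, true) => (mid q r, mid p r, mid p q)
  end.

Definition diam3 (x : E * E * E) : R :=
  Num.max (edist x.1.1 x.1.2) (Num.max (edist x.1.2 x.2) (edist x.1.1 x.2)).

Lemma diam3_ge0 x : 0 <= diam3 x.
Proof. by rewrite /diam3 le_max edist_ge0. Qed.

Lemma diam3_le (p q r : E) M : edist p q <= M -> edist q r <= M -> edist p r <= M ->
  diam3 (p, q, r) <= M.
Proof. by move=> pq qr pr; rewrite /diam3 /= !ge_max pq qr pr. Qed.

Lemma le_diam3 (p q r : E) : [/\ edist p q <= diam3 (p, q, r),
  edist q r <= diam3 (p, q, r) & edist p r <= diam3 (p, q, r)].
Proof. by split; rewrite /diam3 /= !le_max lexx ?orbT. Qed.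

Lemma diam3_swap12 (p q r : E) : diam3 (q, p, r) = diam3 (p, q, r).
Proof.
have [pq qr pr] := le_diam3 p q r; have [qp pr' qr'] := le_diam3 q p r.
by apply/le_anti/andP; split; apply: diam3_le => //; rewrite edistC.
Qed.

Lemma diam3_swap23 (p q r : E) : diam3 (p, r, q) = diam3 (p, q, r).
Proof.
have [pq qr pr] := le_diam3 p q r; have [pr' rq pq'] := le_diam3 p r q.
by apply/le_anti/andP; split; apply: diam3_le => //; rewrite edistC.
Qed.

Lemma diam3_fan_quarter c x : diam3 (fan_quarter c x) <= diam3 x / 2.
Proof.
case: x => [[p q] r]; have [pq qr pr] := le_diam3 p q r.
have half (x y u v : E) : x - y = 2^-1 *: (u - v) ->
    edist u v <= diam3 (p, q, r) -> edist x y <= diam3 (p, q, r) / 2.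
  by move=> e uv; rewrite (edist_half e) ler_wpM2r.
have qp : edist q p <= diam3 (p, q, r) by rewrite edistC.
have rq : edist r q <= diam3 (p, q, r) by rewrite edistC.
have rp : edist r p <= diam3 (p, q, r) by rewrite edistC.
case: c => [[] []] /=; apply: diam3_le.
- by apply: (half _ _ q p) qp; rewrite /mid; vec_eq.
- by apply: (half _ _ r q) rq; rewrite /mid; vec_eq.
- by apply: (half _ _ r p) rp; rewrite /mid; vec_eq.
- by apply: (half _ _ p q) pq; rewrite /mid; vec_eq.
- by apply: (half _ _ q r) qr; rewrite /mid; vec_eq.
- by apply: (half _ _ p r) pr; rewrite /mid; vec_eq.
- by apply: (half _ _ p q) pq; rewrite /mid; vec_eq.
- by apply: (half _ _ q r) qr; rewrite /mid; vec_eq.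
- by apply: (half _ _ p r) pr; rewrite /mid; vec_eq.
- by apply: (half _ _ p q) pq; rewrite /mid; vec_eq.
- by apply: (half _ _ q r) qr; rewrite /mid; vec_eq.
- by apply: (half _ _ p r) pr; rewrite /mid; vec_eq.
Qed.

Lemma refine_fan (U : E * E * E -> R) (p q r : E) :
  refine fan_quarter U (p, q, r) = U (p, mid p q, mid p r)
    + U (mid p q, q, mid q r) + U (mid p r, mid q r, r)
    + U (mid q r, mid p r, mid p q).
Proof. by rewrite /refine sum_bool2 /=; ring. Qed.

Lemma affdep3_line (x v : E) (s1 s2 s3 : R) :
  affdep3 (x + s1 *: v) (x + s2 *: v) (x + s3 *: v).
Proof.
have [e|n] := eqVneq s2 s3; last first.
  exists (s2 - s3), (s3 - s1), (s1 - s2); split; [ring| |vec_eq].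
  by move=> [/eqP]; rewrite subr_eq0 (negbTE n).
rewrite e; exists 0, 1, (-1); split; [ring| |vec_eq].
by move=> [_ /eqP]; rewrite oner_eq0.
Qed.

Variables (K : set E) (cK : convex_set K).
Variables (et : E -> E -> R) (f : E -> R) (a b A B : R).
Hypothesis a0 : 0 < a.
Hypothesis b0 : 0 < b.
Hypothesis ab2 : 2 < a + b.
Hypothesis A0 : 0 <= A.
Hypothesis B0 : 0 <= B.
Hypothesis et_swap : forall p q, K p -> K q -> et q p = - et p q.
Hypothesis et_mid : forall p q, K p -> K q ->
  et p q = et p (mid p q) + et (mid p q) q.
Hypothesis et_line : forall p q r, K p -> K q -> K r -> affdep3 p q r ->
  et q r - et p r + et p q = 0.
Hypothesis et_coboundary : forall p q r M, K p -> K q -> K r ->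
  edist p q <= M -> edist q r <= M -> edist p r <= M ->
  `|et q r - et p r + et p q| <= B * M `^ b.
Hypothesis f_holder : forall p q M, K p -> K q -> edist p q <= M ->
  `|f q - f p| <= A * M `^ a.

(** The germ f (delta eta) on vertices. *)
Definition fan (x : E * E * E) : R :=
  f x.1.1 * (et x.1.2 x.2 - et x.1.1 x.2 + et x.1.1 x.1.2).

Let mu p q r := et q r - et p r + et p q.

Let P (x : E * E * E) := [/\ K x.1.1, K x.1.2 & K x.2].

Lemma fan_quarter_in c x : P x -> P (fan_quarter c x).
Proof.
case: x => [[p q] r] [/= Kp Kq Kr].
by case: c => [[] []]; split => //=; exact: mid_in.
Qed.

Let mu_quarters p q r : K p -> K q -> K r ->
  mu p q r = mu p (mid p q) (mid p r) + mu (mid p q) q (mid q r)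
    + mu (mid p r) (mid q r) r + mu (mid q r) (mid p r) (mid p q).
Proof.
move=> Kp Kq Kr; rewrite /mu (et_mid Kq Kr) (et_mid Kp Kr) (et_mid Kp Kq).
have Kpq := mid_in cK Kp Kq; have Kqr := mid_in cK Kq Kr.
have Kpr := mid_in cK Kp Kr.
have := et_swap Kpq Kpr; have := et_swap Kpq Kqr; have := et_swap Kpr Kqr; lra.
Qed.

Let powRab (x : R) : x `^ (a + b) = x `^ a * x `^ b.
Proof.
rewrite powRD //; apply/implyP => /eqP e; move: a0 b0 e; lra.
Qed.

Let holder_mu x y p q r M : 0 <= M -> K x -> K y -> K p -> K q -> K r ->
  edist x y <= M -> edist p q <= M -> edist q r <= M -> edist p r <= M ->
  `|(f y - f x) * mu p q r| <= A * B * M `^ (a + b).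
Proof.
move=> M0 Kx Ky Kp Kq Kr xy pq qr pr; rewrite normrM powRab.
have -> : A * B * (M `^ a * M `^ b) = (A * M `^ a) * (B * M `^ b) by ring.
by rewrite ler_pM //; [exact: f_holder|exact: et_coboundary].
Qed.

(** Since the coboundary of [et] is additive over the four pieces, the defect
    is the sum of (f(p) - f(x_i)) times its value on the [i]-th piece, where x_i
    is the first vertex of that piece. The vertex x_i of the middle piece is
    reached in two steps along edges, and that of the piece at [p] is [p] itself,
    so there are four such products, each at most A B diam^(a + b). *)
Lemma fan_defect x : P x ->
  `|fan x - refine fan_quarter fan x| <= 4 * A * B * diam3 x `^ (a + b).
Proof.
case: x => [[p q] r] Px; have [/= Kp Kq Kr] := Px.
rewrite refine_fan /fan /=.
have := mu_quarters Kp Kq Kr; rewrite {1}/mu => ->.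
set M := diam3 (p, q, r); have M0 : 0 <= M by exact: diam3_ge0.
have Kpq := mid_in cK Kp Kq; have Kqr := mid_in cK Kq Kr.
have Kpr := mid_in cK Kp Kr.
have [dpq dqr dpr] := le_diam3 p q r.
have mu_le c x y : K x -> K y -> edist x y <= M -> `|(f y - f x)
    * (let: (u, v, w) := fan_quarter c (p, q, r) in mu u v w)|
    <= A * B * M `^ (a + b).
  move=> Kx Ky xy.
  have : diam3 (fan_quarter c (p, q, r)) <= M.
    apply: (le_trans (diam3_fan_quarter _ _)).
    by rewrite -/M ler_pdivrMr // mulr2n mulrDr mulr1 lerDl.
  have := fan_quarter_in c Px.
  case: (fan_quarter c (p, q, r)) => [[u v] w] [/= Ku Kv Kw] uvw.
  have [uv vw uw] := le_diam3 u v w.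
  by apply: holder_mu => //; apply: le_trans uvw.
have hpq : edist p (mid p q) <= M.
  rewrite (@edist_half _ _ _ _ p q) ?ler_pdivrMr // /mid; last by vec_eq.
  by rewrite mulr2n mulrDr mulr1 -[leLHS]addr0 lerD.
have hpr : edist p (mid p r) <= M.
  rewrite (@edist_half _ _ _ _ p r) ?ler_pdivrMr // /mid; last by vec_eq.
  by rewrite mulr2n mulrDr mulr1 -[leLHS]addr0 lerD.
have hqr : edist q (mid q r) <= M.
  rewrite (@edist_half _ _ _ _ q r) ?ler_pdivrMr // /mid; last by vec_eq.
  by rewrite mulr2n mulrDr mulr1 -[leLHS]addr0 lerD.
have k1 := mu_le (false, true) p (mid p q) Kp Kpq hpq.
have k2 := mu_le (true, false) p (mid p r) Kp Kpr hpr.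
have k3 := mu_le (true, true) p q Kp Kq dpq.
have k4 := mu_le (true, true) q (mid q r) Kq Kqr hqr.
have W0 : 0 <= A * B * M `^ (a + b) by rewrite !mulr_ge0 ?powR_ge0.
move: k1 k2 k3 k4 W0; rewrite /= -!/(mu _ _ _).
rewrite !ler_norml -!mulrA.
move=> /andP[a1 c1] /andP[a2 c2] /andP[a3 c3] /andP[a4 c4] W0.
by apply/andP; split; lra.
Qed.

Variables (th : E -> E -> E -> R) (C : R).
Hypothesis C0 : 0 <= C.
Hypothesis th_quarters : forall p q r, K p -> K q -> K r ->
  th p q r = th p (mid p q) (mid p r) + th (mid p q) q (mid q r)
           + th (mid p r) (mid q r) r + th (mid q r) (mid p r) (mid p q).
Hypothesis th_near : forall p q r, K p -> K q -> K r ->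
  `|th p q r - f p * (et q r - et p r + et p q)| <= C * diam3 (p, q, r) `^ (a + b).

Let q4 : 4 * 2^-1 `^ (a + b) < 1 :> R. Proof. exact: (@half_powR_lt1 R 2). Qed.

Let q4' : #|{: bool * bool}|%:R * 2^-1 `^ (a + b) < 1 :> R.
Proof. by rewrite card_prod card_bool. Qed.

Let ab0 : 0 < a + b. Proof. by rewrite addr_gt0. Qed.

Let diam3_quarter c x : P x -> diam3 (fan_quarter c x) <= diam3 x / 2.
Proof. by move=> _; exact: diam3_fan_quarter. Qed.

Lemma fan_swap12 p q r : K p -> K q -> K r -> th q p r = - th p q r.
Proof.
move=> Kp Kq Kr.
pose U (x : E * E * E) := th x.1.1 x.1.2 x.2 + th x.1.2 x.1.1 x.2.
suff : U (p, q, r) = 0 by rewrite /U /=; lra.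
apply: (@refine_fixed_eq0 R _ _ fan_quarter P diam3 _ fan_quarter_in diam3_ge0
  diam3_quarter ab0 q4' U (2 * C + A * B)) => //.
- by rewrite addr_ge0 ?mulr_ge0.
- move=> [[x y] z] [/= Kx Ky Kz]; rewrite /U /=.
  have [xy yz xz] := le_diam3 x y z.
  have h1 := th_near Kx Ky Kz; have h2 := th_near Ky Kx Kz.
  have e : diam3 (y, x, z) = diam3 (x, y, z).
    exact: diam3_swap12.
  rewrite e in h2.
  have h3 := holder_mu (diam3_ge0 (x, y, z)) Ky Kx Kx Ky Kz.
  rewrite (edistC y x) in h3; have {}h3 := h3 xy xy yz xz.
  have s := et_swap Kx Ky.
  move: h1 h2 h3; rewrite /mu s !ler_norml.
  move=> /andP[a1 c1] /andP[a2 c2] /andP[a3 c3].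
  by apply/andP; split; lra.
- move=> [[x y] z] [/= Kx Ky Kz]; rewrite refine_fan /U /=.
  have := th_quarters Kx Ky Kz; have := th_quarters Ky Kx Kz.
  have -> : mid y x = mid x y by rewrite /mid addrC.
  lra.
Qed.

Lemma fan_swap23 p q r : K p -> K q -> K r -> th p r q = - th p q r.
Proof.
move=> Kp Kq Kr.
pose U (x : E * E * E) := th x.1.1 x.1.2 x.2 + th x.1.1 x.2 x.1.2.
suff : U (p, q, r) = 0 by rewrite /U /=; lra.
apply: (@refine_fixed_eq0 R _ _ fan_quarter P diam3 _ fan_quarter_in diam3_ge0
  diam3_quarter ab0 q4' U (2 * C)) => //.
- by rewrite mulr_ge0.
- move=> [[x y] z] [/= Kx Ky Kz]; rewrite /U /=.
  have h1 := th_near Kx Ky Kz; have h2 := th_near Kx Kz Ky.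
  have e : diam3 (x, z, y) = diam3 (x, y, z).
    exact: diam3_swap23.
  rewrite e in h2.
  have s := et_swap Ky Kz.
  move: h1 h2; rewrite s !ler_norml => /andP[a1 c1] /andP[a2 c2].
  by apply/andP; split; lra.
- move=> [[x y] z] [/= Kx Ky Kz]; rewrite refine_fan /U /=.
  have := th_quarters Kx Ky Kz; have := th_quarters Kx Kz Ky.
  have -> : mid z y = mid y z by rewrite /mid addrC.
  lra.
Qed.

(** On collinear triples [fan] vanishes, since [et] is additive on lines; so
    [th] is bounded there by its distance to [fan], and it is additive over the
    pieces of a flat triangle, which are flat. *)
Lemma fan_line p q (t : R) : K p -> K q -> 0 <= t <= 1 ->
  th p (p + t *: (q - p)) q = 0.
Proof.
move=> Kp Kq t01.
pose L (x : E * E * E) := P x /\ exists (y v : E) (s1 s2 s3 : R),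
  x = (y + s1 *: v, y + s2 *: v, y + s3 *: v).
pose U (x : E * E * E) := th x.1.1 x.1.2 x.2.
rewrite -/(U (p, p + t *: (q - p), q)).
apply: (@refine_fixed_eq0 R _ _ fan_quarter L diam3 _ _ diam3_ge0
  _ ab0 q4' U C) => //.
- move=> c x [Px [y [v [s1 [s2 [s3 e]]]]]]; split; first exact: fan_quarter_in.
  exists y, v; rewrite e; case: c => [[] []].
  + exists ((s2 + s3) / 2), ((s1 + s3) / 2), ((s1 + s2) / 2).
    by congr (_, _, _); rewrite /mid; vec_eq.
  + exists ((s1 + s3) / 2), ((s2 + s3) / 2), s3.
    by congr (_, _, _); rewrite /mid; vec_eq.
  + exists ((s1 + s2) / 2), s2, ((s2 + s3) / 2).
    by congr (_, _, _); rewrite /mid; vec_eq.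
  + exists s1, ((s1 + s2) / 2), ((s1 + s3) / 2).
    by congr (_, _, _); rewrite /mid; vec_eq.
- by move=> c x [Px _]; exact: diam3_quarter.
- move=> x [Px [y [v [s1 [s2 [s3 e]]]]]]; move: Px; rewrite e => -[/= K1 K2 K3].
  have := th_near K1 K2 K3; rewrite et_line //; last exact: affdep3_line.
  by rewrite mulr0 subr0.
- by move=> [[x y] z] [[/= Kx Ky Kz] _]; rewrite refine_fan /U /= -th_quarters.
- split; first by split => //; exact: cK.
  by exists p, (q - p), 0, t, 1; congr (_, _, _); vec_eq.
Qed.

(** The coboundary of [fan] is the product of the difference of [f] along the
    first edge with the coboundary of [et] on the last three vertices. *)
Lemma fan_coboundary p q r s M : K p -> K q -> K r -> K s ->
  edist p q <= M -> edist p r <= M -> edist p s <= M ->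
  edist q r <= M -> edist q s <= M -> edist r s <= M ->
  `|th q r s - th p r s + th p q s - th p q r| <= (4 * C + A * B) * M `^ (a + b).
Proof.
move=> Kp Kq Kr Ks pq pr ps qr qs rs.
have M0 : 0 <= M by apply: le_trans pq; exact: edist_ge0.
have near x y z : K x -> K y -> K z -> edist x y <= M -> edist y z <= M ->
    edist x z <= M -> `|th x y z - f x * (et y z - et x z + et x y)|
    <= C * M `^ (a + b).
  move=> Kx Ky Kz xy yz xz; apply: (le_trans (th_near Kx Ky Kz)).
  by rewrite ler_wpM2l // powR_mono ?diam3_ge0 ?(ltW ab0) // diam3_le.
have h1 := near _ _ _ Kq Kr Ks qr rs qs.
have h2 := near _ _ _ Kp Kr Ks pr rs ps.
have h3 := near _ _ _ Kp Kq Ks pq qs ps.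
have h4 := near _ _ _ Kp Kq Kr pq qr pr.
have h5 := holder_mu M0 Kp Kq Kq Kr Ks pq qr rs qs.
move: h1 h2 h3 h4 h5; rewrite /mu !ler_norml.
move=> /andP[a1 c1] /andP[a2 c2] /andP[a3 c3] /andP[a4 c4] /andP[a5 c5].
by apply/andP; split; lra.
Qed.

Hypothesis f_cont : forall (ps : nat -> E) p, (forall j, K (ps j)) -> K p ->
  ps @ \oo --> p -> f \o ps @ \oo --> f p.
Hypothesis et_cont : forall (ps qs : nat -> E) p q,
  (forall j, K (ps j)) -> (forall j, K (qs j)) -> K p -> K q ->
  ps @ \oo --> p -> qs @ \oo --> q ->
  (fun j => et (ps j) (qs j)) @ \oo --> et p q.

Lemma fan_cont (ps qs rs : nat -> E) p q r :
  (forall j, K (ps j)) -> (forall j, K (qs j)) -> (forall j, K (rs j)) ->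
  K p -> K q -> K r -> ps @ \oo --> p -> qs @ \oo --> q -> rs @ \oo --> r ->
  (fun j => th (ps j) (qs j) (rs j)) @ \oo --> th p q r.
Proof.
move=> Kps Kqs Krs Kp Kq Kr cp cq cr.
pose Q (xs : nat -> E * E * E) (x : E * E * E) :=
  [/\ P x, forall j, P (xs j), exists M, forall j, diam3 (xs j) <= M &
    [/\ (fun j => (xs j).1.1) @ \oo --> x.1.1,
    (fun j => (xs j).1.2) @ \oo --> x.1.2 & (fun j => (xs j).2) @ \oo --> x.2]].
apply: (@refine_fixed_cvg R _ _ fan_quarter P diam3 _ fan_quarter_in diam3_ge0
  diam3_quarter ab0 q4' Q (fun x => th x.1.1 x.1.2 x.2) fan C C0 _ _ _ _ _ _
  (fun j => (ps j, qs j, rs j)) (p, q, r)).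
- move=> xs [[x y] z] c [Px Pxs [M HM] [c1 c2 c3]]; split.
  + exact: fan_quarter_in.
  + by move=> j; exact: fan_quarter_in.
  + exists (M / 2) => j; apply: (le_trans (diam3_fan_quarter c _)).
    by rewrite ler_wpM2r.
  + have e j c' : fan_quarter c' (xs j)
        = fan_quarter c' ((xs j).1.1, (xs j).1.2, (xs j).2) by case: (xs j) => [[]].
    by case: c => [[] []]; rewrite /comp; split;
      under [X in X @ \oo --> _]eq_fun do rewrite e /=; rewrite //=; exact: cvg_mid.
- by move=> xs x [].
- by move=> xs x [].
- move=> xs x [[K1 K2 K3] Pxs _ [c1 c2 c3]].
  have Ks1 j : K (xs j).1.1 by have [] := Pxs j.
  have Ks2 j : K (xs j).1.2 by have [] := Pxs j.
  have Ks3 j : K (xs j).2 by have [] := Pxs j.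
  apply: cvgM; first exact: (f_cont Ks1).
  by apply: cvgD; [apply: cvgB|]; exact: et_cont.
- by move=> [[x y] z] [/= Kx Ky Kz]; rewrite refine_fan /= -th_quarters.
- by move=> [[x y] z] [/= Kx Ky Kz]; exact: th_near.
- split; [by []|by move=> j; split; [exact: Kps|exact: Kqs|exact: Krs]| |by []].
  have bdd (us vs : nat -> E) (u v : E) : us @ \oo --> u -> vs @ \oo --> v ->
      exists M, forall j, edist (us j) (vs j) <= M.
    move=> cu cv; have /cvg_seq_bounded [M [_ HM]] : cvgn (fun j => us j - vs j).
      by apply: is_cvgB; [apply: cvgP cu|apply: cvgP cv].
    exists (d%:R * (M + 1)) => j.
    apply: (@le_trans _ _ (d%:R * `|us j - vs j|)); first exact: edist_le_norm.
    by rewrite ler_wpM2l //; apply: HM => //; rewrite ltrDl.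
  have [M1 h1] := bdd _ _ _ _ cp cq; have [M2 h2] := bdd _ _ _ _ cq cr.
  have [M3 h3] := bdd _ _ _ _ cp cr.
  exists (Num.max M1 (Num.max M2 M3)) => j.
  by apply: diam3_le; rewrite !le_max ?h1 ?h2 ?h3 ?orbT.
Qed.

Let th_bound z p q r s M : K p -> K q -> K r -> K s ->
  `|p - z| <= M -> `|q - z| <= M -> `|r - z| <= M -> `|s - z| <= M ->
  `|th q r s - th p r s + th p q s - th p q r|
    <= (4 * C + A * B) * (d%:R * 2) `^ (a + b) * M `^ (a + b).
Proof.
move=> Kp Kq Kr Ks pz qz rz sz; rewrite -mulrA -powRM //; last exact: le_trans pz.
by apply: fan_coboundary => //; apply: (edist_le_center (z := z)).
Qed.

Let bound_ge0 : 0 <= (4 * C + A * B) * (d%:R * 2) `^ (a + b).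
Proof. by rewrite mulr_ge0 ?powR_ge0 ?addr_ge0 ?mulr_ge0. Qed.

Lemma fan_closed p q r s : K p -> K q -> K r -> K s -> affdep4 p q r s ->
  th q r s - th p r s + th p q s - th p q r = 0.
Proof.
exact: (surface_closed cK ab0 bound_ge0 q4 fan_swap12 fan_swap23 fan_line th_quarters
  th_bound fan_cont).
Qed.

Lemma fan_nonatomic p q r : K p -> K q -> K r -> affdep3 p q r -> th p q r = 0.
Proof.
apply: (alternating_affdep3 fan_swap12 fan_swap23).
exact: (surface_split cK ab0 bound_ge0 q4 fan_swap12 fan_swap23 fan_line th_quarters
  th_bound fan_cont).
Qed.

End Fan.

(** * Simplices and germs *)

Section Hull.
Variables (R : realType) (d : nat).
Local Notation E := 'rV[R]_d.

Lemma convex_combination (K : set E) (n : nat) (t : 'I_n -> R) (p : 'I_n -> E) :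
  convex_set K -> (forall i, 0 <= t i) -> (forall i, K (p i)) ->
  0 < \sum_i t i -> K ((\sum_i t i)^-1 *: \sum_i t i *: p i).
Proof.
move=> cK; elim: n t p => [|n IH] t p t0 Kp; first by rewrite big_ord0 ltxx.
rewrite !big_ord_recr /=; set T := \sum_(i < n) _; set s := \sum_(i < n) _ *: _.
set u := t ord_max; set x := p ord_max => Tu0.
have T0 : 0 <= T by exact: sumr_ge0.
have u0 : 0 <= u by exact: t0.
have [T0'|Tn0] := eqVneq T 0.
  have -> : s = 0.
    rewrite /s big1 // => i _.
    have /eqP := T0'; rewrite psumr_eq0 //=.
    move=> /allP /(_ i (mem_index_enum i)) /eqP ->.
    by rewrite scale0r.
  have u1 : u != 0 by move: Tu0; rewrite T0' add0r => /lt0r_neq0.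
  by rewrite T0' !add0r scalerA mulVf // scale1r; exact: Kp.
have Tp : 0 < T by rewrite lt_neqAle eq_sym Tn0.
have Ks : K (T^-1 *: s).
  by apply: IH => [i|i|]; [exact: t0|exact: Kp|exact: Tp].
apply: (convex_seg (t := u / (T + u)) cK Ks (Kp ord_max)).
  by rewrite divr_ge0 ?(ltW Tu0) //= ler_pdivrMr // mul1r lerDr.
rewrite -/x; apply/rowP => j; rewrite !mxE; field.
by rewrite Tn0 lt0r_neq0.
Qed.

Lemma conv_hull_sub (K : set E) (k : nat) (p : 'I_k.+1 -> E) :
  convex_set K -> (forall i, K (p i)) -> conv_hull p `<=` K.
Proof.
move=> cK Kp x [t [t0 t1 ->]].
have := @convex_combination K _ t p cK t0 Kp.
by rewrite t1 ltr01 invr1 scale1r; exact.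
Qed.

Lemma conv_hull_convex (k : nat) (p : 'I_k.+1 -> E) : convex_set (conv_hull p).
Proof.
move=> x y s /andP[s0 s1] [t [t0 t1 ->]] [u [u0 u1 ->]].
exists (fun i => (1 - s) * t i + s * u i); split.
- by move=> i; rewrite addr_ge0 ?mulr_ge0 ?subr_ge0.
- by rewrite big_split /= -!mulr_sumr t1 u1 !mulr1 subrK.
- have mix (X Y : E) : X + s *: (Y - X) = (1 - s) *: X + s *: Y by vec_eq.
  rewrite mix !scaler_sumr -big_split /=.
  by apply: eq_bigr => i _; rewrite [RHS]scalerDl !scalerA.
Qed.

Lemma vertex_in_hull (k : nat) (p : 'I_k.+1 -> E) i : conv_hull p (p i).
Proof.
exists (fun j => (j == i)%:R); split.
- by move=> j; rewrite ler0n.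
- by rewrite (bigD1 i) //= eqxx big1 ?addr0 // => j /negbTE ->.
- rewrite (bigD1 i) //= eqxx scale1r big1 ?addr0 // => j /negbTE ->.
  by rewrite scale0r.
Qed.

End Hull.

Section Germs.
Variables (R : realType) (d : nat) (D : set 'rV[R]_d).
Local Notation E := 'rV[R]_d.

(** Germs are functions of simplices, which carry a proof of inclusion in
    [D]; vertex lists avoid transporting these proofs. *)
Definition has_vertices (k : nat) (S : simplex D k) (s : seq E) :=
  forall i, S i = s`_i.

(** The value of a germ on a list of vertices, extended by 0 to the tuples
    that do not span a simplex of [D]. *)
Definition germ_at (k : nat) (w : germ D k) (s : seq E) : R :=
  if pselect (conv_hull (fun i : 'I_k.+1 => s`_i) `<=` D) is left H
  then w (Simplex H) else 0.

Lemma germ_ext (k : nat) (w : germ D k) (S T : simplex D k) :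
  (forall i, S i = T i) -> w S = w T.
Proof.
case: S T => v H [v' H'] /= e.
have {}e : v = v' by apply/funext.
by move: H; rewrite e => H; congr (w (Simplex _)); exact: Prop_irrelevance.
Qed.

Lemma germ_atE (k : nat) (w : germ D k) (S : simplex D k) s :
  has_vertices S s -> w S = germ_at w s.
Proof.
move=> vs; rewrite /germ_at; case: pselect => [H|]; first exact: germ_ext.
case; have -> : (fun i : 'I_k.+1 => s`_i) = S by apply/funext => i; rewrite vs.
exact: simplex_conv.
Qed.

Lemma simplex_in (K : set E) (k : nat) (s : seq E) :
  convex_set K -> K `<=` D -> (forall i, (i < k.+1)%N -> K s`_i) ->
  exists S : simplex D k, has_vertices S s.
Proof.
move=> cK KD Ks.
have H : conv_hull (fun i : 'I_k.+1 => s`_i) `<=` D.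
  by apply: (subset_trans _ KD); apply: conv_hull_sub => // i; exact: Ks.
by exists (Simplex H).
Qed.

Lemma reindex_vertices (k m : nat) (h : 'I_m.+1 -> 'I_k.+1) (S : simplex D k) s s' :
  has_vertices S s -> (forall i, s`_(h i) = s'`_i) ->
  has_vertices (reindex_simplex h S) s'.
Proof. by move=> vs e i; rewrite -e -vs. Qed.

Lemma delta_germ0E (g : E -> R) (S : simplex D 1) p q : has_vertices S [:: p; q] ->
  delta (germ0 D g) S = g q - g p.
Proof.
move=> v; rewrite /delta !big_ord_recl big_ord0 /= /germ0 /= !v /=.
by rewrite expr0 expr1 mul1r mulN1r addr0.
Qed.

Lemma delta_germ1E (w : germ D 1) (S : simplex D 2) p q r : has_vertices S [:: p; q; r] ->
  delta w S = germ_at w [:: q; r] - germ_at w [:: p; r] + germ_at w [:: p; q].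
Proof.
move=> v; rewrite /delta !big_ord_recl big_ord0 /=.
rewrite (@germ_atE _ w _ [:: q; r]); last first.
  by apply: (reindex_vertices v) => -[[|[|]]].
rewrite (@germ_atE _ w _ [:: p; r]); last first.
  by apply: (reindex_vertices v) => -[[|[|]]].
rewrite (@germ_atE _ w _ [:: p; q]); last first.
  by apply: (reindex_vertices v) => -[[|[|]]].
rewrite /bump /=; ring.
Qed.

Lemma delta_germ2E (w : germ D 2) (S : simplex D 3) p q r s :
  has_vertices S [:: p; q; r; s] ->
  delta w S = germ_at w [:: q; r; s] - germ_at w [:: p; r; s] + germ_at w [:: p; q; s]
    - germ_at w [:: p; q; r].
Proof.
move=> v; rewrite /delta !big_ord_recl big_ord0 /=.
rewrite (@germ_atE _ w _ [:: q; r; s]); last first.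
  by apply: (reindex_vertices v) => -[[|[|[|]]]].
rewrite (@germ_atE _ w _ [:: p; r; s]); last first.
  by apply: (reindex_vertices v) => -[[|[|[|]]]].
rewrite (@germ_atE _ w _ [:: p; q; s]); last first.
  by apply: (reindex_vertices v) => -[[|[|[|]]]].
rewrite (@germ_atE _ w _ [:: p; q; r]); last first.
  by apply: (reindex_vertices v) => -[[|[|[|]]]].
rewrite /bump /=; ring.
Qed.

Lemma cup_germ0E (k : nat) (g : E -> R) (w : germ D k) (S : simplex D k) :
  (cup (germ0 D g) w : germ D k) S = g (S ord0) * w S.
Proof.
rewrite /cup /germ0 /=; congr (g (S _) * _); first by apply/val_inj; rewrite /= inordK.
by apply: germ_ext => i /=; congr (S _); exact: inord_val.
Qed.

Lemma cup11E (g1 g2 : E -> R) (S : simplex D 2) p q r : has_vertices S [:: p; q; r] ->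
  cup (delta (germ0 D g1)) (delta (germ0 D g2)) S = (g1 q - g1 p) * (g2 r - g2 q).
Proof.
move=> v; rewrite /cup (@delta_germ0E g1 _ p q) ?(@delta_germ0E g2 _ q r) //.
- by apply: (reindex_vertices v) => -[[|[|]]] //= i; rewrite inordK.
- by apply: (reindex_vertices v) => -[[|[|]]] //= i; rewrite inordK.
Qed.

Lemma edist_le_diam (k : nat) (S : simplex D k) i j : edist (S i) (S j) <= diam S.
Proof.
apply: le_trans (le_bigmax _ _ i).
exact: (le_bigmax 0 (fun j => edist (S i) (S j)) j).
Qed.

Lemma diam_le (k : nat) (S : simplex D k) M : 0 <= M ->
  (forall i j, edist (S i) (S j) <= M) -> diam S <= M.
Proof. by move=> M0 SM; apply: bigmax_le => // i _; apply: bigmax_le. Qed.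

Lemma diam_edge (S : simplex D 1) p q : has_vertices S [:: p; q] -> diam S = edist p q.
Proof.
move=> v; apply/le_anti/andP; split.
  apply: diam_le => [|i j]; first exact: edist_ge0.
  by rewrite !v; case: i j => [[|[|]]] // ? [[|[|]]] //= ?;
    rewrite ?edistxx ?edist_ge0 // edistC.
by have := edist_le_diam S ord0 ord_max; rewrite !v.
Qed.

Lemma diam_triangle (S : simplex D 2) p q r : has_vertices S [:: p; q; r] ->
  diam S = diam3 (p, q, r).
Proof.
move=> v; have [pq qr pr] := le_diam3 p q r; apply/le_anti/andP; split.
  apply: diam_le => [|i j]; first exact: diam3_ge0.
  by rewrite !v; case: i j => [[|[|[|]]]] // ? [[|[|[|]]]] //= ?;
    rewrite ?edistxx ?diam3_ge0 // edistC.
have o1 : (1 < 3)%N by [].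
have e0 := v ord0; have e1 := v (Ordinal o1); have e2 := v ord_max.
rewrite /= in e0 e1 e2.
by apply: diam3_le; rewrite -?e0 -?e1 -?e2; exact: edist_le_diam.
Qed.

Lemma germ_norm_ge0 (k : nat) g (w : germ D k) : (0 <= germ_norm g w)%E.
Proof. by apply/ereal_infP => _ [c [c0 _] <-]; rewrite lee_fin. Qed.

Lemma germ_norm_le (k : nat) g (w : germ D k) (c : R) : 0 <= c ->
  (forall S, `|w S| <= c * diam S `^ g) -> (germ_norm g w <= c%:E)%E.
Proof. by move=> c0 cw; apply: ge_ereal_inf; exists c%:E => //; exists c. Qed.

(** A finite infimum of admissible constants is itself admissible, as the
    condition on each simplex is closed. *)
Lemma germ_norm_bound (k : nat) g (w : germ D k) : (germ_norm g w < +oo)%E ->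
  exists N : R, [/\ 0 <= N, germ_norm g w = N%:E &
    forall S, `|w S| <= N * diam S `^ g].
Proof.
move=> fin; have := germ_norm_ge0 g w; move: fin.
case E : (germ_norm g w) => [N| |] // _; rewrite lee_fin => N0.
exists N; split => // S; apply/ler_addgt0Pr => e e0.
(* The added 1 keeps the denominator positive when the simplex is a point. *)
have s0 : 0 < diam S `^ g + 1 by rewrite ltr_wpDl ?powR_ge0.
have : (germ_norm g w < (N + e / (diam S `^ g + 1))%:E)%E.
  by rewrite E lte_fin ltrDl divr_gt0.
move=> /ereal_inf_lt [_ [c [c0 cw] <-]]; rewrite lte_fin => cN.
apply: (le_trans (cw S)).
apply: (@le_trans _ _ ((N + e / (diam S `^ g + 1)) * diam S `^ g)).
  by rewrite ler_wpM2r ?powR_ge0 // ltW.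
rewrite mulrDl lerD2l mulrAC ler_pdivrMr // ler_wpM2l ?(ltW e0) //.
by rewrite lerDl.
Qed.

Lemma in_affine_line (k : nat) (s : 'I_k.+1 -> R) (x v : E) (p : 'I_k.+1 -> E) :
  (forall i, p i = x + s i *: v) -> exists2 m, (m < 2)%N & in_affine m p.
Proof.
move=> e; exists (\dim <[v]>)%VS; first by rewrite dim_vline; case: (v != 0).
exists x, <[v]>%VS; split => // i.
by rewrite e addrAC subrr add0r memvZ // memv_line.
Qed.

End Germs.

(** * Regular germs *)

Section Affine.
Variables (R : realType) (d : nat).
Local Notation E := 'rV[R]_d.

Lemma not_free_relation (n : nat) (X : n.-tuple E) (V : {vspace E}) :
  (\dim V < n)%N -> (forall i : 'I_n, X`_i \in V) ->
  exists2 c : 'I_n -> R, \sum_i c i *: X`_i = 0 & exists i, c i != 0.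
Proof.
move=> Vn XV; have : ~~ free X.
  apply/negP => fX; move: Vn; rewrite ltnNge => /negP; apply.
  have /eqP <- : \dim <<X>> == n by move: fX; rewrite /free size_tuple.
  apply: dimvS; apply/span_subvP => x /(nthP 0) [i]; rewrite size_tuple => ilt <-.
  exact: (XV (Ordinal ilt)).
move=> /freeP /existsNP [c /not_implyP [c0 cn]]; exists c => //.
apply/not_existsP => h; apply: cn => i; apply/eqP/negPn/negP; exact: h.
Qed.

(** The two differences with the last point lie in a space of dimension at
    most 1, so they are linearly dependent. *)
Lemma in_affine_affdep3 (m : nat) (p : 'I_3 -> E) x y z : (m < 2)%N -> in_affine m p ->
  (forall i, p i = [:: x; y; z]`_i) -> affdep3 x y z.
Proof.
move=> m2 [q [V [Vm pV]]] e.
have mem i : [:: x; y; z]`_(i : 'I_3) - q \in V by rewrite -e.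
have Vx := mem ord0; have Vy := mem (@Ordinal 3 1 isT); have Vz := mem ord_max.
rewrite /= in Vx Vy Vz.
have [||c c0 [i ci]] := @not_free_relation 2 [tuple x - z; y - z] V.
- by rewrite Vm.
- have dz u : u - q \in V -> u - z \in V.
    move=> uV; have -> : u - z = (u - q) - (z - q) by vec_eq.
    exact: rpredB.
  by case=> [[|[|]]] //= _; exact: dz.
move: c0; rewrite !big_ord_recl big_ord0 /= addr0; set a := c _; set b := c _ => c0.
exists a, b, (- (a + b)); split; [ring| |].
- move=> [a0 b0]; case: i ci => [[|[|]]] // ilt /eqP; apply.
  + by rewrite -a0; congr c; exact: val_inj.
  + by rewrite -b0; congr c; exact: val_inj.
- by rewrite -c0; vec_eq.
Qed.

Lemma in_affine_affdep4 (m : nat) (p : 'I_4 -> E) x y z t : (m < 3)%N -> in_affine m p ->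
  (forall i, p i = [:: x; y; z; t]`_i) -> affdep4 x y z t.
Proof.
move=> m3 [q [V [Vm pV]]] e.
have mem i : [:: x; y; z; t]`_(i : 'I_4) - q \in V by rewrite -e.
have Vx := mem ord0; have Vy := mem (@Ordinal 4 1 isT).
have Vz := mem (@Ordinal 4 2 isT); have Vt := mem ord_max.
rewrite /= in Vx Vy Vz Vt.
have [||c c0 [i ci]] := @not_free_relation 3 [tuple x - t; y - t; z - t] V.
- by rewrite Vm.
- have dt u : u - q \in V -> u - t \in V.
    move=> uV; have -> : u - t = (u - q) - (t - q) by vec_eq.
    exact: rpredB.
  by case=> [[|[|[|]]]] //= _; exact: dt.
move: c0; rewrite !big_ord_recl big_ord0 /= addr0.
set a := c _; set b := c _; set e' := c _ => c0.
exists a, b, e', (- (a + b + e')); split; [ring| |].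
- move=> [a0 b0 e0]; case: i ci => [[|[|[|]]]] // ilt /eqP; apply.
  + by rewrite -a0; congr c; exact: val_inj.
  + by rewrite -b0; congr c; exact: val_inj.
  + by rewrite -e0; congr c; exact: val_inj.
- by rewrite -c0; vec_eq.
Qed.

End Affine.

Section Regular.
Variables (R : realType) (d : nat) (D : set 'rV[R]_d).
Local Notation E := 'rV[R]_d.
Variables (K : set E) (cK : convex_set K) (KD : K `<=` D).

Lemma regular1_diag (w : germ D 1) p : regular w -> K p -> germ_at w [:: p; p] = 0.
Proof.
move=> [na _] Kp.
have [S v] : exists S : simplex D 1, has_vertices S [:: p; p].
  by apply: (simplex_in (K := K)) => // -[|[|]].
rewrite -(germ_atE w v); apply: na; exists 0%N => //.
exists p, 0%VS; split; first exact: dimv0.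
by move=> i; rewrite v memv0; case: i => [[|[|]]] //= _; rewrite subrr.
Qed.

(** Closedness applies to a genuine line only; when the direction vanishes
    the points coincide and nonatomicity takes over. *)
Lemma regular1_line (w : germ D 1) x v (s1 s2 s3 : R) : regular w ->
  K (x + s1 *: v) -> K (x + s2 *: v) -> K (x + s3 *: v) ->
  germ_at w [:: x + s2 *: v; x + s3 *: v] - germ_at w [:: x + s1 *: v; x + s3 *: v]
    + germ_at w [:: x + s1 *: v; x + s2 *: v] = 0.
Proof.
move=> rw K1 K2 K3; have [v0|vn] := eqVneq v 0.
  move: K1; rewrite v0 !scaler0 addr0 => Kx.
  by rewrite !regular1_diag // subrr addr0.
have [S vS] : exists S : simplex D 2,
    has_vertices S [:: x + s1 *: v; x + s2 *: v; x + s3 *: v].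
  by apply: (simplex_in (K := K)) => // -[|[|[|]]].
rewrite -(delta_germ1E w vS); apply: rw.2; exists x, <[v]>%VS; split.
  by rewrite dim_vline vn.
by move=> i; rewrite vS; case: i => [[|[|[|]]]] //= _;
  rewrite addrAC subrr add0r memvZ // memv_line.
Qed.

Lemma regular1_mid (w : germ D 1) p q : regular w -> K p -> K q ->
  germ_at w [:: p; q] = germ_at w [:: p; mid p q] + germ_at w [:: mid p q; q].
Proof.
move=> rw Kp Kq; have Km := mid_in cK Kp Kq.
have e0 : p = p + 0 *: (q - p) by vec_eq.
have e1 : q = p + 1 *: (q - p) by vec_eq.
have em : mid p q = p + 2^-1 *: (q - p) by rewrite /mid; vec_eq.
have := @regular1_line w p (q - p) 0 2^-1 1 rw.
rewrite -e0 -e1 -em => /(_ Kp Km Kq); lra.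
Qed.

Lemma regular2_line (w : germ D 2) x v (s1 s2 s3 : R) : regular w ->
  K (x + s1 *: v) -> K (x + s2 *: v) -> K (x + s3 *: v) ->
  germ_at w [:: x + s1 *: v; x + s2 *: v; x + s3 *: v] = 0.
Proof.
move=> [na _] K1 K2 K3.
have [S vS] : exists S : simplex D 2,
    has_vertices S [:: x + s1 *: v; x + s2 *: v; x + s3 *: v].
  by apply: (simplex_in (K := K)) => // -[|[|[|]]].
rewrite -(germ_atE w vS); apply: na.
apply: (in_affine_line (s := fun i => [:: s1; s2; s3]`_i) (x := x) (v := v)).
by move=> i; rewrite vS; case: i => [[|[|[|]]]].
Qed.

(** Closedness applies when the two directions span a plane; otherwise all
    four triangles are flat and nonatomicity makes each term vanish. *)
Lemma regular2_plane (w : germ D 2) x u v (p q r s : E) : regular w ->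
  K p -> K q -> K r -> K s ->
  (forall y, y \in [:: p; q; r; s] -> exists a b : R, y = x + a *: u + b *: v) ->
  germ_at w [:: q; r; s] - germ_at w [:: p; r; s] + germ_at w [:: p; q; s]
    - germ_at w [:: p; q; r] = 0.
Proof.
move=> rw Kp Kq Kr Ks span.
pose V := (<[u]> + <[v]>)%VS.
have VE y : y \in [:: p; q; r; s] -> y - x \in V.
  move=> /span [a [b ->]]; have -> : x + a *: u + b *: v - x = a *: u + b *: v by vec_eq.
  by rewrite memv_add // memvZ // memv_line.
have V2 : (\dim V <= 2)%N.
  apply: (leq_trans (dimv_add_leqif _ _)); rewrite !dim_vline.
  by case: (u != 0); case: (v != 0).
move: V2; rewrite leq_eqVlt => /orP[/eqP V2|V2].
  have [S vS] : exists S : simplex D 3, has_vertices S [:: p; q; r; s].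
    by apply: (simplex_in (K := K)) => // -[|[|[|[|]]]].
  rewrite -(delta_germ2E w vS); apply: rw.2; exists x, V; split => // i.
  rewrite vS; apply: VE; case: i => [[|[|[|[|]]]]] //= _;
    by rewrite !inE eqxx ?orbT.
have flat y z t : K y -> K z -> K t -> y \in [:: p; q; r; s] ->
    z \in [:: p; q; r; s] -> t \in [:: p; q; r; s] -> germ_at w [:: y; z; t] = 0.
  move=> Ky Kz Kt yl zl tl.
  have [S vS] : exists S : simplex D 2, has_vertices S [:: y; z; t].
    by apply: (simplex_in (K := K)) => // -[|[|[|]]].
  rewrite -(germ_atE w vS); apply: rw.1; exists (\dim V) => //.
  exists x, V; split => // i.
  by rewrite vS; case: i => [[|[|[|]]]] //= _; exact: VE.
rewrite !flat ?subrr ?addr0 ?subrr //; by rewrite !inE eqxx ?orbT.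
Qed.

(** Insert the midpoints one after the other, using the coboundary on four
    coplanar points; the last two relations reorder the vertices of the middle
    and corner triangles, as a regular germ is alternating on planes. *)
Lemma regular2_quarters (w : germ D 2) p q r : regular w -> K p -> K q -> K r ->
  germ_at w [:: p; q; r] = germ_at w [:: p; mid p q; mid p r]
    + germ_at w [:: mid p q; q; mid q r]
    + germ_at w [:: mid p r; mid q r; r] + germ_at w [:: mid q r; mid p r; mid p q].
Proof.
move=> rw Kp Kq Kr; set a := mid p q; set b := mid q r; set c := mid p r.
have Ka : K a by exact: mid_in.
have Kb : K b by exact: mid_in.
have Kc : K c by exact: mid_in.
pose Sp y := K y /\ exists s t : R, y = p + s *: (q - p) + t *: (r - p).
have Pp : Sp p by split => //; exists 0, 0; vec_eq.
have Pq : Sp q by split => //; exists 1, 0; vec_eq.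
have Pr : Sp r by split => //; exists 0, 1; vec_eq.
have Pa : Sp a by split => //; exists 2^-1, 0; rewrite /a /mid; vec_eq.
have Pb : Sp b by split => //; exists 2^-1, 2^-1; rewrite /b /mid; vec_eq.
have Pc : Sp c by split => //; exists 0, 2^-1; rewrite /c /mid; vec_eq.
have plane x y z t : Sp x -> Sp y -> Sp z -> Sp t -> germ_at w [:: y; z; t]
    - germ_at w [:: x; z; t] + germ_at w [:: x; y; t] - germ_at w [:: x; y; z] = 0.
  move=> [Kx Px] [Ky Py] [Kz Pz] [Kt Pt].
  apply: (@regular2_plane w p (q - p) (r - p)) => // u.
  by rewrite !inE => /or4P[] /eqP ->.
have line o v x y z (s1 s2 s3 : R) : K x -> K y -> K z -> x = o + s1 *: v ->
    y = o + s2 *: v -> z = o + s3 *: v -> germ_at w [:: x; y; z] = 0.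
  move=> Kx Ky Kz ex ey ez; rewrite ex in Kx *; rewrite ey in Ky *.
  by rewrite ez in Kz *; exact: (regular2_line rw Kx Ky Kz).
have l1 : germ_at w [:: p; a; q] = 0.
  by apply: (@line p (q - p) _ _ _ 0 2^-1 1) => //; rewrite /a /mid; vec_eq.
have l2 : germ_at w [:: q; b; r] = 0.
  by apply: (@line q (r - q) _ _ _ 0 2^-1 1) => //; rewrite /b /mid; vec_eq.
have l3 : germ_at w [:: p; c; r] = 0.
  by apply: (@line p (r - p) _ _ _ 0 2^-1 1) => //; rewrite /c /mid; vec_eq.
have l4 : germ_at w [:: b; b; r] = 0.
  by apply: (@line b (r - b) _ _ _ 0 0 1) => //; vec_eq.
have l5 : germ_at w [:: b; c; b] = 0.
  by apply: (@line b (c - b) _ _ _ 0 1 0) => //; vec_eq.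
have l6 : germ_at w [:: a; c; a] = 0.
  by apply: (@line a (c - a) _ _ _ 0 1 0) => //; vec_eq.
have l7 : germ_at w [:: a; b; a] = 0.
  by apply: (@line a (b - a) _ _ _ 0 1 0) => //; vec_eq.
have k1 := plane _ _ _ _ Pp Pa Pq Pr.
have k2 := plane _ _ _ _ Pa Pq Pb Pr.
have k3 := plane _ _ _ _ Pp Pa Pc Pr.
have k4 := plane _ _ _ _ Pa Pb Pc Pr.
have k5 := plane _ _ _ _ Pb Pc Pb Pr.
have k6 := plane _ _ _ _ Pa Pb Pc Pa.
lra.
Qed.

End Regular.

(** * The Young integral as a germ *)

Section Sewing.
Variables (R : realType) (d : nat) (D : set 'rV[R]_d).
Local Notation E := 'rV[R]_d.

Lemma within_seq_cvg (K : set E) (f : E -> R) : {within D, continuous f} ->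
  K `<=` D -> forall (ps : nat -> E) p, (forall j, K (ps j)) -> K p ->
  ps @ \oo --> p -> f \o ps @ \oo --> f p.
Proof.
move=> /subspace_continuousP fD KD ps p Kps Kp cp.
move=> B HB; have := cp _ (fD p (KD _ Kp) B HB).
case=> n _ hn; exists n => // j nj /=; exact: (hn j nj (KD _ (Kps j))).
Qed.

Lemma germ_holder (K : set E) (f : E -> R) (a A : R) : 0 <= a -> 0 <= A ->
  (forall S, `|delta (germ0 D f) S| <= A * diam S `^ a) ->
  convex_set K -> K `<=` D -> forall p q M, K p -> K q -> edist p q <= M ->
  `|f q - f p| <= A * M `^ a.
Proof.
move=> a0 A0 H cK KD p q M Kp Kq pq.
have [S v] : exists S : simplex D 1, has_vertices S [:: p; q].
  by apply: (simplex_in (K := K)) => // -[|[|]].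
have := H S; rewrite (delta_germ0E f v) (diam_edge v) => h.
by apply: (le_trans h); rewrite ler_wpM2l // powR_mono ?edist_ge0.
Qed.

Lemma germ_cup_bound (K : set E) (g1 g2 : E -> R) (b B : R) : 0 <= b -> 0 <= B ->
  (forall S, `|cup (delta (germ0 D g1)) (delta (germ0 D g2)) S| <= B * diam S `^ b) ->
  convex_set K -> K `<=` D -> forall p q r M, K p -> K q -> K r ->
  edist p q <= M -> edist q r <= M -> edist p r <= M ->
  `|(g1 q - g1 p) * (g2 r - g2 q)| <= B * M `^ b.
Proof.
move=> b0 B0 H cK KD p q r M Kp Kq Kr pq qr pr.
have [S v] : exists S : simplex D 2, has_vertices S [:: p; q; r].
  by apply: (simplex_in (K := K)) => // -[|[|[|]]].
have := H S; rewrite (cup11E g1 g2 v) (diam_triangle v) => h.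
by apply: (le_trans h); rewrite ler_wpM2l // powR_mono ?diam3_ge0 // diam3_le.
Qed.

Lemma own_vertices1 (S : simplex D 1) : has_vertices S [:: S ord0; S ord_max].
Proof. by case=> [[|[|]]] //= i; congr (S _); exact: val_inj. Qed.

Lemma own_vertices2 (S : simplex D 2) :
  has_vertices S [:: S ord0; S (@Ordinal 3 1 isT); S ord_max].
Proof. by case=> [[|[|[|]]]] //= i; congr (S _); exact: val_inj. Qed.

Lemma own_vertices3 (S : simplex D 3) :
  has_vertices S [:: S ord0; S (@Ordinal 4 1 isT); S (@Ordinal 4 2 isT); S ord_max].
Proof. by case=> [[|[|[|[|]]]]] //= i; congr (S _); exact: val_inj. Qed.

Section Young.
Variables (g1 g2 : E -> R) (b B : R).
Hypothesis b1 : 1 < b.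
Hypothesis B0 : 0 <= B.
Hypothesis g1_cont : {within D, continuous g1}.
Hypothesis g2_cont : {within D, continuous g2}.
Hypothesis gB : forall S,
  `|cup (delta (germ0 D g1)) (delta (germ0 D g2)) S| <= B * diam S `^ b.

Let young_germ : germ D 1 := cup (germ0 D g1) (delta (germ0 D g2)).
Let wf (x : E * E) := g1 x.1 * (g2 x.2 - g2 x.1).

Let b0 : 0 < b. Proof. exact: lt_trans b1. Qed.

Let q1 : #|{: bool}|%:R * 2^-1 `^ b < 1 :> R.
Proof. by rewrite card_bool; exact: (@half_powR_lt1 R 1). Qed.

Let C1 : R := (1 - 2 * 2^-1 `^ b)^-1.

Let C1_ge0 : 0 <= C1.
Proof. by rewrite invr_ge0 subr_ge0 ltW //; move: q1; rewrite card_bool. Qed.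

Let wf_defect (K : set E) : convex_set K -> K `<=` D -> forall x, K x.1 -> K x.2 ->
  `|wf x - refine (@chord_half R d) wf x| <= B * edist x.1 x.2 `^ b.
Proof.
move=> cK KD [p q] /= Kp Kq; rewrite refine_chord /wf /=.
have Km := mid_in cK Kp Kq.
have hl (x y : E) : x - y = 2^-1 *: (p - q) -> edist x y <= edist p q.
  move=> e; rewrite (edist_half e) ler_pdivrMr // mulr2n mulrDr mulr1 lerDl.
  exact: edist_ge0.
have := germ_cup_bound (ltW b0) B0 gB cK KD Kp Km Kq (M := edist p q).
move=> /(_ (hl _ _ _) (hl _ _ _) (lexx _)); rewrite -normrN => h.
have -> : g1 p * (g2 q - g2 p) - (g1 (mid p q) * (g2 q - g2 (mid p q))
    + g1 p * (g2 (mid p q) - g2 p))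
  = - ((g1 (mid p q) - g1 p) * (g2 q - g2 (mid p q))) by ring.
by apply: h; rewrite /mid; vec_eq.
Qed.

Lemma young_germE (S : simplex D 1) p q : has_vertices S [:: p; q] ->
  young_germ S = wf (p, q).
Proof. by move=> v; rewrite /young_germ cup_germ0E (delta_germ0E g2 v) v. Qed.

(** The limit of the Riemann sums is one function on all pairs that lie in a
    common convex subset of [D]; its regularity is checked on the convex hull
    of each simplex. *)
Lemma young_sewable : sewable b young_germ.
Proof.
pose P (x : E * E) := exists K : set E, [/\ convex_set K, K `<=` D, K x.1 & K x.2].
have Phalf c x : P x -> P (chord_half c x).
  move=> [K [cK KD K1 K2]]; exists K; split => //; case: c => //=; exact: mid_in.
have [U [Ufix Unear]] := @refine_limit R _ _ (@chord_half R d) P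
  (fun x => edist x.1 x.2) b Phalf (fun x => edist_ge0 _ _)
  (fun c x _ => chord_half_le c x) b0 q1 wf B B0
  (fun x '(ex_intro K (And4 cK KD K1 K2)) => wf_defect cK KD K1 K2).
set C := B / _ in Unear.
have C0 : 0 <= C by rewrite divr_ge0 // subr_ge0 ltW.
pose e : germ D 1 := fun S => U (S ord0, S ord_max).
have inK (K : set E) : convex_set K -> K `<=` D ->
    (forall p q, K p -> K q -> U (p, q) = U (p, mid p q) + U (mid p q, q)) /\
    (forall p q, K p -> K q ->
       `|U (p, q) - g1 p * (g2 q - g2 p)| <= C * edist p q `^ b).
  move=> cK KD; split=> p q Kp Kq; last by apply: Unear; exists K.
  by rewrite -Ufix ?refine_chord 1?addrC //; exists K.
have swapK (K : set E) : convex_set K -> K `<=` D -> forall p q, K p -> K q ->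
    U (q, p) = - U (p, q).
  move=> cK KD; have [h1 h2] := inK K cK KD.
  exact: (@chord_swap R d K cK (fun p q => U (p, q)) g1 g2 b B C b1 B0 C0 h1 h2
    (germ_cup_bound (ltW b0) B0 gB cK KD)).
exists e; split; [split|].
- move=> S [m]; rewrite ltnS leqn0 => /eqP -> [x [V [/eqP]]].
  rewrite dimv_eq0 => /eqP -> h.
  have h' i : S i = x by apply/eqP; rewrite -subr_eq0 -memv0.
  have Kx : conv_hull S x by rewrite -(h' ord0); exact: vertex_in_hull.
  have := swapK _ (@conv_hull_convex _ _ _ S) (@simplex_conv _ _ _ _ S) x x Kx Kx.
  rewrite /e !h'; lra.
- move=> T hT; have v := own_vertices2 T.
  have cK := @conv_hull_convex _ _ _ T; have KD := @simplex_conv _ _ _ _ T.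
  have KT i : conv_hull T (T i) by exact: vertex_in_hull.
  move: v; set p := T ord0; set q := T (Ordinal _); set r := T ord_max => v.
  rewrite (delta_germ1E e v).
  have germ_atU x y : conv_hull T x -> conv_hull T y -> germ_at e [:: x; y] = U (x, y).
    move=> Kx Ky; have [S vS] : exists S : simplex D 1, has_vertices S [:: x; y].
      by apply: (simplex_in cK KD) => -[|[|]].
    by rewrite -(germ_atE e vS) /e !vS.
  rewrite !germ_atU; try exact: KT.
  have [h1 h2] := inK _ cK KD.
  apply: (@chord_closed R d _ cK (fun p q => U (p, q)) g1 g2 b B C b1 B0 C0 h1 h2
    (germ_cup_bound (ltW b0) B0 gB cK KD)) => //; try exact: KT.
  + exact: within_seq_cvg.
  + exact: within_seq_cvg.
  + exact: (in_affine_affdep3 _ hT v).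
- apply: (@le_lt_trans _ _ C%:E); last by rewrite ltry.
  apply: germ_norm_le => // S; have v := own_vertices1 S.
  rewrite /= (young_germE v) (diam_edge v) distrC; apply: Unear.
  exists (conv_hull S); split; [exact: conv_hull_convex|exact: simplex_conv| |];
    exact: vertex_in_hull.
Qed.

Let et (p q : E) := germ_at (young D b g1 g2) [:: p; q].

Lemma young_is_sew : is_sew b young_germ (young D b g1 g2).
Proof. exact: (xgetPex (fun=> 0) young_sewable). Qed.

Section OnConvex.
Variables (K : set E) (cK : convex_set K) (KD : K `<=` D).

Lemma young_mid p q : K p -> K q -> et p q = et p (mid p q) + et (mid p q) q.
Proof. exact: (regular1_mid cK KD young_is_sew.1). Qed.

(** The germ is a sewing chosen by its definition only up to a finite
    constant; its regularity and [refine_defect_bound] make the constant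
    explicit. *)
Lemma young_near p q : K p -> K q ->
  `|et p q - g1 p * (g2 q - g2 p)| <= C1 * B * edist p q `^ b.
Proof.
move=> Kp Kq; have [N [N0 _ HN]] := germ_norm_bound young_is_sew.2.
pose P (x : E * E) := K x.1 /\ K x.2.
have Phalf c x : P x -> P (chord_half c x).
  by case: c => -[K1 K2]; split => //=; exact: mid_in.
have := @refine_defect_bound R _ _ (@chord_half R d) P
  (fun x => edist x.1 x.2) b Phalf (fun x => edist_ge0 _ _)
  (fun c x _ => chord_half_le c x) b0 q1
  (fun x => et x.1 x.2 - wf x) N B N0 B0 _ _ (p, q).
rewrite /C1 (mulrC _^-1) card_bool; apply => //.
- move=> [x y] [/= Kx Ky].
  have [S v] : exists S : simplex D 1, has_vertices S [:: x; y].
    by apply: (simplex_in cK KD) => -[|[|]].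
  by have := HN S; rewrite /= (young_germE v) (germ_atE _ v) (diam_edge v) distrC.
- move=> [x y] [/= Kx Ky]; rewrite refineB.
  have := wf_defect cK KD (x := (x, y)) Kx Ky; rewrite -normrN.
  congr (`|_| <= _); rewrite [refine _ (fun x => et _ _) _]refine_chord /=.
  by rewrite (young_mid Kx Ky); ring.
Qed.

Let gBK := germ_cup_bound (ltW b0) B0 gB cK KD.

Let C1B0 : 0 <= C1 * B. Proof. by rewrite mulr_ge0. Qed.

Lemma young_swap p q : K p -> K q -> et q p = - et p q.
Proof. exact: (chord_swap cK b1 B0 C1B0 young_mid young_near gBK). Qed.

Lemma young_coboundary p q r M : K p -> K q -> K r ->
  edist p q <= M -> edist q r <= M -> edist p r <= M ->
  `|et q r - et p r + et p q| <= (3 * C1 + 1) * B * M `^ b.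
Proof.
move=> Kp Kq Kr pq qr pr.
have -> : (3 * C1 + 1) * B = 3 * (C1 * B) + B by ring.
exact: (chord_coboundary b1 C1B0 young_near gBK).
Qed.

Lemma young_cont (ps qs : nat -> E) p q :
  (forall j, K (ps j)) -> (forall j, K (qs j)) -> K p -> K q ->
  ps @ \oo --> p -> qs @ \oo --> q ->
  (fun j => et (ps j) (qs j)) @ \oo --> et p q.
Proof.
exact: (chord_cont cK b1 C1B0 young_mid young_near (within_seq_cvg g1_cont KD)
  (within_seq_cvg g2_cont KD)).
Qed.

Lemma young_line p q r : K p -> K q -> K r -> affdep3 p q r ->
  et q r - et p r + et p q = 0.
Proof.
exact: (chord_closed cK b1 B0 C1B0 young_mid young_near gBK
  (within_seq_cvg g1_cont KD) (within_seq_cvg g2_cont KD)).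
Qed.

End OnConvex.
End Young.
End Sewing.

(** * The iterated integral *)

Section FanGerm.
Variables (R : realType) (d : nat) (D : set 'rV[R]_d).
Local Notation E := 'rV[R]_d.
Variables (f g1 g2 : E -> R) (a b A B : R).
Hypothesis a0 : 0 < a.
Hypothesis b1 : 1 < b.
Hypothesis ab2 : 2 < a + b.
Hypothesis A0 : 0 <= A.
Hypothesis B0 : 0 <= B.
Hypothesis f_cont : {within D, continuous f}.
Hypothesis g1_cont : {within D, continuous g1}.
Hypothesis g2_cont : {within D, continuous g2}.
Hypothesis fA : forall S, `|delta (germ0 D f) S| <= A * diam S `^ a.
Hypothesis gB : forall S,
  `|cup (delta (germ0 D g1)) (delta (germ0 D g2)) S| <= B * diam S `^ b.

Let fan_germ : germ D 2 := cup (germ0 D f) (delta (young D b g1 g2)).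
Let et (p q : E) := germ_at (young D b g1 g2) [:: p; q].
Let C1 : R := (1 - 2 * 2^-1 `^ b)^-1.
Let B' : R := (3 * C1 + 1) * B.
Let q2 : R := #|{: bool * bool}|%:R * 2^-1 `^ (a + b).

Let b0 : 0 < b. Proof. exact: lt_trans b1. Qed.
Let ab0 : 0 < a + b. Proof. by rewrite addr_gt0. Qed.

Let q2E : q2 = 4 * 2^-1 `^ (a + b).
Proof. by rewrite /q2 card_prod card_bool. Qed.

Let q2_lt1 : q2 < 1. Proof. by rewrite q2E; exact: (@half_powR_lt1 R 2). Qed.

Let B'0 : 0 <= B'.
Proof.
rewrite mulr_ge0 // addr_ge0 // mulr_ge0 // invr_ge0 subr_ge0 ltW //.
exact: (@half_powR_lt1 R 1).
Qed.

Let D0 : 0 <= 4 * A * B'.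
Proof. by apply: mulr_ge0 B'0; exact: mulr_ge0. Qed.

Lemma fan_germE (S : simplex D 2) p q r : has_vertices S [:: p; q; r] ->
  fan_germ S = fan et f (p, q, r).
Proof.
move=> v; rewrite /fan_germ (cup_germ0E f (delta (young D b g1 g2) : germ D 2)).
by rewrite (delta_germ1E _ v) v.
Qed.

Let fanP (x : E * E * E) :=
  exists K : set E, [/\ convex_set K, K `<=` D & [/\ K x.1.1, K x.1.2 & K x.2]].

Let fan_defectK (K : set E) : convex_set K -> K `<=` D -> forall x,
  [/\ K x.1.1, K x.1.2 & K x.2] ->
  `|fan et f x - refine (@fan_quarter R d) (fan et f) x|
    <= 4 * A * B' * diam3 x `^ (a + b).
Proof.
move=> cK KD x.
exact: (fan_defect cK a0 b0 A0 B'0 (young_swap b1 B0 g1_cont g2_cont gB cK KD)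
  (young_mid b1 B0 g1_cont g2_cont gB cK KD)
  (young_coboundary b1 B0 g1_cont g2_cont gB cK KD)
  (germ_holder (ltW a0) A0 fA cK KD)).
Qed.

(** As in dimension one, the limit is a single function on all triples that
    lie in a common convex subset of [D], studied on the hull of each
    simplex. *)
Lemma fan_germ_sewable : sewable (a + b) fan_germ.
Proof.
have Pquarter c x : fanP x -> fanP (fan_quarter c x).
  move=> [K [cK KD Kx]]; exists K; split => //; exact: (fan_quarter_in cK).
have [U [Ufix Unear]] := @refine_limit R _ _ (@fan_quarter R d) fanP
  (@diam3 R d) (a + b) Pquarter (@diam3_ge0 R d)
  (fun c x _ => diam3_fan_quarter c x) ab0 q2_lt1 (fan et f) _ D0
  (fun x '(ex_intro K (And3 cK KD Kx)) => fan_defectK cK KD Kx).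
set C := 4 * A * B' / _ in Unear.
have C0 : 0 <= C by rewrite divr_ge0 // subr_ge0 ltW.
pose e : germ D 2 := fun S => U (S ord0, S (@Ordinal 3 1 isT), S ord_max).
pose th p q r := U (p, q, r).
have quarters (K : set E) : convex_set K -> K `<=` D -> forall p q r,
    K p -> K q -> K r ->
    th p q r = th p (mid p q) (mid p r) + th (mid p q) q (mid q r)
           + th (mid p r) (mid q r) r + th (mid q r) (mid p r) (mid p q).
  by move=> cK KD p q r Kp Kq Kr; rewrite /th -Ufix ?refine_fan //; exists K.
have near (K : set E) : convex_set K -> K `<=` D -> forall p q r,
    K p -> K q -> K r ->
    `|th p q r - f p * (et q r - et p r + et p q)|
      <= C * diam3 (p, q, r) `^ (a + b).
  by move=> cK KD p q r Kp Kq Kr; apply: Unear; exists K.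
exists e; split; [split|].
- move=> S [m m2 hS]; have v := own_vertices2 S.
  have cK := @conv_hull_convex _ _ _ S; have KD := @simplex_conv _ _ _ _ S.
  apply: (fan_nonatomic cK a0 b0 ab2 A0 B'0 (young_swap b1 B0 g1_cont g2_cont gB cK KD)
    (young_line b1 B0 g1_cont g2_cont gB cK KD)
    (young_coboundary b1 B0 g1_cont g2_cont gB cK KD)
    (germ_holder (ltW a0) A0 fA cK KD) C0 (quarters _ cK KD) (near _ cK KD)
    (within_seq_cvg f_cont KD) (young_cont b1 B0 g1_cont g2_cont gB cK KD));
    try exact: vertex_in_hull.
  exact: (in_affine_affdep3 m2 hS v).
- move=> T hT; have v := own_vertices3 T.
  have cK := @conv_hull_convex _ _ _ T; have KD := @simplex_conv _ _ _ _ T.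
  have KT i : conv_hull T (T i) by exact: vertex_in_hull.
  rewrite (delta_germ2E e v).
  have germ_atU x y z : conv_hull T x -> conv_hull T y -> conv_hull T z ->
      germ_at e [:: x; y; z] = th x y z.
    move=> Kx Ky Kz; have [S vS] : exists S : simplex D 2, has_vertices S [:: x; y; z].
      by apply: (simplex_in cK KD) => -[|[|[|]]].
    by rewrite -(germ_atE e vS) /e !vS.
  rewrite !germ_atU; try exact: KT.
  apply: (fan_closed cK a0 b0 ab2 A0 B'0 (young_swap b1 B0 g1_cont g2_cont gB cK KD)
    (young_line b1 B0 g1_cont g2_cont gB cK KD)
    (young_coboundary b1 B0 g1_cont g2_cont gB cK KD)
    (germ_holder (ltW a0) A0 fA cK KD) C0 (quarters _ cK KD) (near _ cK KD)
    (within_seq_cvg f_cont KD) (young_cont b1 B0 g1_cont g2_cont gB cK KD));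
    try exact: KT.
  exact: (in_affine_affdep4 _ hT v).
- apply: (@le_lt_trans _ _ C%:E); last by rewrite ltry.
  apply: germ_norm_le => // S; have v := own_vertices2 S.
  rewrite /= (fan_germE v) (diam_triangle v) distrC; apply: Unear.
  exists (conv_hull S); split; [exact: conv_hull_convex|exact: simplex_conv|].
  by split; exact: vertex_in_hull.
Qed.

(** The sewing is regular, hence additive over the four pieces, so its
    difference with [fan] has the same defect as [fan]. *)
Lemma fan_germ_sew_norm : (germ_norm (a + b) (fan_germ \- sew (a + b) fan_germ)%R <=
  (4 * (3 * C1 + 1) / (1 - 4 * 2^-1 `^ (a + b)) * A * B)%:E)%E.
Proof.
have [reg fin] : is_sew (a + b) fan_germ (sew (a + b) fan_germ).
  exact: (xgetPex (fun=> 0) fan_germ_sewable).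
have [N [N0 _ HN]] := germ_norm_bound fin.
have -> : 4 * (3 * C1 + 1) / (1 - 4 * 2^-1 `^ (a + b)) * A * B
    = 4 * A * B' / (1 - q2) by rewrite q2E /B'; ring.
apply: germ_norm_le; first by rewrite divr_ge0 // subr_ge0 ltW.
move=> S0.
have cK := @conv_hull_convex _ _ _ S0; have KD := @simplex_conv _ _ _ _ S0.
set K := conv_hull S0 in cK KD.
pose P (x : E * E * E) := [/\ K x.1.1, K x.1.2 & K x.2].
pose e (x : E * E * E) := germ_at (sew (a + b) fan_germ) [:: x.1.1; x.1.2; x.2].
have simp x : P x -> exists S : simplex D 2, has_vertices S [:: x.1.1; x.1.2; x.2].
  by move=> [K1 K2 K3]; apply: (simplex_in cK KD) => -[|[|[|]]].
have main := @refine_defect_bound R _ _ (@fan_quarter R d) P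
  (@diam3 R d) (a + b) (fan_quarter_in cK) (@diam3_ge0 R d)
  (fun c x _ => diam3_fan_quarter c x) ab0 q2_lt1
  (fun x => fan et f x - e x) N _ N0 D0.
have v := own_vertices2 S0.
rewrite /= (fan_germE v) (germ_atE _ v) (diam_triangle v).
apply: (main _ _ (S0 ord0, S0 (@Ordinal 3 1 isT), S0 ord_max)).
- move=> [[x y] z] Px; have [S vS] := simp _ Px.
  by have := HN S; rewrite /= (fan_germE vS) (germ_atE _ vS) (diam_triangle vS).
- move=> [[x y] z] Px; have [Kx Ky Kz] := Px; rewrite refineB.
  have := fan_defectK cK KD Px; congr (`|_| <= _).
  rewrite [refine _ e _]refine_fan /e /= -(regular2_quarters cK KD reg Kx Ky Kz).
  ring.
- by split; exact: vertex_in_hull.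
Qed.

End FanGerm.

Theorem theorem4p10 (R : realType) (alpha beta : R)
    (halpha : 0 < alpha) (hbeta : 1 < beta) (hgamma : 2 < alpha + beta) :
  exists c : R, forall (d : nat) (D : set 'rV[R]_d) (f g1 g2 : 'rV[R]_d -> R),
    {within D, continuous f} ->
    {within D, continuous g1} ->
    {within D, continuous g2} ->
    (germ_norm alpha (delta (germ0 D f)) +
     germ_norm beta (cup (delta (germ0 D g1)) (delta (germ0 D g2))) < +oo)%E ->
    let w : germ D 2 := cup (germ0 D f) (delta (young D beta g1 g2)) in
    sewable (alpha + beta) w /\
    (germ_norm (alpha + beta) (w \- sew (alpha + beta) w)%R <=
       c%:E * germ_norm alpha (delta (germ0 D f)) *
       germ_norm beta (cup (delta (germ0 D g1)) (delta (germ0 D g2))))%E.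
Proof.
exists (4 * (3 * (1 - 2 * 2^-1 `^ beta)^-1 + 1) / (1 - 4 * 2^-1 `^ (alpha + beta))).
move=> d D f g1 g2 fc g1c g2c fin w.
have finf : (germ_norm alpha (delta (germ0 D f)) < +oo)%E.
  by apply: le_lt_trans fin; rewrite leeDl // germ_norm_ge0.
have fing : (germ_norm beta (cup (delta (germ0 D g1)) (delta (germ0 D g2))) < +oo)%E.
  by apply: le_lt_trans fin; rewrite leeDr // germ_norm_ge0.
have [A [A0 EA fA]] := germ_norm_bound finf.
have [B [B0 EB gB]] := germ_norm_bound fing.
split; first exact: (fan_germ_sewable halpha hbeta hgamma A0 B0 fc g1c g2c fA gB).
rewrite EA EB -!EFinM.
exact: (fan_germ_sew_norm halpha hbeta hgamma A0 B0 fc g1c g2c fA gB).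
Qed.
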